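(* Let $\xi=(\xi_1,\dots,\xi_T)$ with $\xi_t\in\Xi_t$, where $\Xi_t\subseteq\mathbb{R}^m$ is non-empty and closed for each $t\le T$, and let $\Xi=\Xi_1\times\dots\times\Xi_T$. Assume that the loss function is of the form $$\ell(\xi)=\sum_{t=1}^T\max_{k\le K}\ell_{tk}(\xi_t)$$ with measurable $\ell_{tk}:\mathbb{R}^m\to\overline{\mathbb{R}}$, and that the Wasserstein ball is defined through the process norm $\|\xi\|_{\mathrm T}=\sum_{t=1}^T\|\xi_t\|$. Then, for any $\varepsilon\ge0$, the worst-case expectation $\sup_{\mathbb{Q}\in\mathbb{B}_\varepsilon(\widehat{\mathbb{P}}_N)}\mathbb{E}^{\mathbb{Q}}[\ell(\xi)]$ is smaller than or equal to the optimal value of the finite convex program $$\begin{array}{cll}\inf\limits_{\lambda,s_{ti},z_{tik},\nu_{tik}}&\lambda\varepsilon+\frac1N\sum\limits_{i=1}^N\sum\limits_{t=1}^Ts_{ti}&\\ \text{s.t.}&[-\ell_{tk}]^*(z_{tik}-\nu_{tik})+\sigma_{\Xi_t}(\nu_{tik})-\langle z_{tik},\widehat\xi_{ti}\rangle\le s_{ti}&\forall i\le N,\ \forall k\le K,\ \forall t\le T\\ &\|z_{tik}\|_*\le\lambda&\forall i\le N,\ \forall k\le K,\ \forall t\le T,\end{array}$$ where $\lambda,s_{ti}\in\mathbb{R}$ and $z_{tik},\nu_{tik}\in\mathbb{R}^m$. If, for every $t\le T$, the set $\Xi_t$ is convex and closed, the functions $-\ell_{tk}$ are proper, convex and lower semicontinuous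 for all $k\le K$, and $\ell_{tk}$ is not identically $-\infty$ on $\Xi_t$ for all $k\le K$, then the worst-case expectation coincides exactly with the optimal value of this program.
   Context: Notation: $\overline{\mathbb{R}}=\mathbb{R}\cup\{-\infty,\infty\}$; $\langle a,b\rangle=a^\top b$; $\|\cdot\|$ is an arbitrary (base) norm on $\mathbb{R}^m$ with dual norm $\|z\|_*=\sup_{\|\zeta\|\le1}\langle z,\zeta\rangle$. A function $f:\mathbb{R}^m\to\overline{\mathbb{R}}$ is proper if $f(\zeta)<+\infty$ for at least one $\zeta$ and $f(\zeta)>-\infty$ for all $\zeta$. Conjugate: $f^*(z)=\sup_{\zeta\in\mathbb{R}^m}\langle z,\zeta\rangle-f(\zeta)$. Support function: $\sigma_{\Xi_t}(z)=\sup_{\zeta\in\Xi_t}\langle z,\zeta\rangle$. Conventions of extended arithmetic: $\infty\cdot0=0\cdot\infty=0/0=0$ and $\infty-\infty=-\infty+\infty=1/0=\infty$. Expectations are $\mathbb{E}^{\mathbb{Q}}[\ell(\xi)]=\mathbb{E}^{\mathbb{Q}}[\max\{\ell(\xi),0\}]+\mathbb{E}^{\mathbb{Q}}[\min\{\ell(\xi),0\}]$ under these conventions. Data and ball: $\widehat\xi_i=(\widehat\xi_{1i},\dots,\widehat\xi_{Ti})\in\Xi$, $i\le N$, are given points and $\widehat{\mathbb{P}}_N=\frac1N\sum_{i=1}^N\delta_{\widehat\xi_i}$. $\mathcal{M}(\Xi)$ is the set of probability distributions $\mathbb{Q}$ supported on $\Xi$ with $\mathbb{E}^{\mathbb{Q}}[\|\xi\|_{\mathrm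 T}]<\infty$; $d_{\mathrm W}(\mathbb{Q}_1,\mathbb{Q}_2)=\inf_\Pi\int_{\Xi^2}\|\xi-\xi'\|_{\mathrm T}\,\Pi(d\xi,d\xi')$ over joint distributions $\Pi$ with marginals $\mathbb{Q}_1,\mathbb{Q}_2$; $\mathbb{B}_\varepsilon(\widehat{\mathbb{P}}_N)=\{\mathbb{Q}\in\mathcal{M}(\Xi):d_{\mathrm W}(\widehat{\mathbb{P}}_N,\mathbb{Q})\le\varepsilon\}$. *)

(* Defs.v *)
From HB Require Import structures.
From mathcomp Require Import all_boot all_order all_algebra.
From mathcomp Require Import all_classical all_reals all_analysis.
From mathcomp Require Import measurable_realfun.

Set Implicit Arguments.
Unset Strict Implicit.
Unset Printing Implicit Defensive.

Import Order.TTheory GRing.Theory Num.Theory.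
Import numFieldNormedType.Exports.

Local Open Scope classical_set_scope.
Local Open Scope ring_scope.

Notation borelType X := (g_sigma_algebraType (@open X)).

(* Points of R^m are row vectors; a process xi = (xi_1, ..., xi_T) is the
   T x m matrix whose row t is xi_t.  Sums in which both infinities may occur
   are taken in the scope %dE, whose addition satisfies
   +oo + -oo = -oo + +oo = +oo; the default addition of \bar R has the
   opposite convention.  The product of \bar R satisfies 0 * +oo = 0. *)

Section convex_analysis.
Context {R : realType} {m : nat}.
Implicit Types (z : 'rV[R]_m) (f : 'rV[R]_m -> \bar R) (A : set 'rV[R]_m).

Definition dotp (a b : 'rV[R]_m) : R := (a *m b^T) 0 0.

Record is_norm (p : 'rV[R]_m -> R) : Prop := IsNorm {
  norm_triangle : forall x y, p (x + y) <= p x + p y ;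
  norm_homogeneous : forall (a : R) x, p (a *: x) = `|a| * p x ;
  norm_definite : forall x, p x = 0 -> x = 0 }.

Definition dual_norm (p : 'rV[R]_m -> R) z : \bar R :=
  ereal_sup [set (dotp z zeta)%:E | zeta in [set zeta | p zeta <= 1]].

Definition conjugate f z : \bar R :=
  ereal_sup [set ((dotp z zeta)%:E - f zeta)%E | zeta in [set: 'rV[R]_m]].

Definition support_function A z : \bar R :=
  ereal_sup [set (dotp z zeta)%:E | zeta in A].

Definition proper_function f : Prop :=
  (exists zeta, (f zeta < +oo)%E) /\ (forall zeta, (-oo < f zeta)%E).

Definition econvex_function f : Prop :=
  forall (x y : 'rV[R]_m) (a : R), 0 <= a -> a <= 1 ->
    (f (a *: x + (1 - a) *: y)%R <= a%:E * f x + (1 - a)%R%:E * f y)%dE.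

End convex_analysis.

Section expectation.
Context {d : measure_display} {X : measurableType d} {R : realType}.

Definition eexpectation (Q : probability X R) (f : X -> \bar R) : \bar R :=
  ((\int[Q]_x maxe (f x) 0)%E + (\int[Q]_x mine (f x) 0)%E)%dE.

Definition empirical (N : nat) (x : 'I_N -> X) (A : set X) : \bar R :=
  ((N%:R^-1)%:E * \sum_(i < N) \d_(x i) A)%E.

Section empirical_measure.
Variables (N : nat) (x : 'I_N -> X).

Let empirical0 : empirical x set0 = 0%E.
Proof. by rewrite /empirical big1 ?mule0// => i _; rewrite measure0. Qed.

Let empirical_ge0 (A : set X) : (0 <= empirical x A)%E.
Proof. by rewrite mule_ge0 ?lee_fin ?invr_ge0// sume_ge0. Qed.

Let empirical_sigma_additive : semi_sigma_additive (empirical x).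
Proof.
case: N x => [|n] y.
  have -> : empirical y = mzero :> (set X -> \bar R).
    by apply/funext => A; rewrite /empirical big_ord0 mule0.
  exact: measure_semi_sigma_additive.
have iN : (0 <= n.+1%:R^-1 :> R) by rewrite invr_ge0.
have -> : empirical y = mscale (NngNum iN)
    (msum (fun k => dirac (y (inord k))) n.+1) :> (set X -> \bar R).
  apply/funext => A; rewrite /empirical /mscale /msum /=; congr (_ * _)%E.
  by apply: eq_bigr => i _; rewrite inord_val.
exact: measure_semi_sigma_additive.
Qed.

HB.instance Definition _ := isMeasure.Build _ _ _ (empirical x)
  empirical0 empirical_ge0 empirical_sigma_additive.

End empirical_measure.

Definition coupling (P Q : {measure set X -> \bar R}) :
    set (probability (X * X)%type R) :=
  [set Pi | forall A, measurable A ->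
     Pi (A `*` setT) = P A /\ Pi (setT `*` A) = Q A].

End expectation.

Section wasserstein.
Context {R : realType} {T m : nat}.
Local Notation process := 'M[R]_(T, m).
Variables (nrm : 'rV[R]_m -> R) (Xi : 'I_T -> set 'rV[R]_m).

Definition process_norm (xi : process) : R := \sum_(t < T) nrm (row t xi).

Definition process_set : set process := [set xi | forall t, Xi t (row t xi)].

Definition wasserstein (P Q : {measure set (borelType process) -> \bar R}) :
    \bar R :=
  ereal_inf [set (\int[Pi]_(p in process_set `*` process_set)
                    (process_norm ((p.1 : process) - (p.2 : process)))%:E)%E
            | Pi in coupling P Q].

Definition distributions : set (probability (borelType process) R) :=
  [set Q : probability (borelType process) R | Q process_set = 1%E /\
           (\int[Q]_xi (process_norm xi)%:E < +oo)%E].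

Definition wasserstein_ball (eps : R)
    (P : {measure set (borelType process) -> \bar R}) :
    set (probability (borelType process) R) :=
  [set Q : probability (borelType process) R | distributions Q /\ (wasserstein P Q <= eps%:E)%E].

End wasserstein.

Section separable_loss.
Context {R : realType} {T m K N : nat}.
Local Notation process := 'M[R]_(T, m).
Variables (nrm : 'rV[R]_m -> R) (Xi : 'I_T -> set 'rV[R]_m).
Variable l : 'I_T -> 'I_K -> 'rV[R]_m -> \bar R.
Variables (xihat : 'I_N -> process) (eps : R).

(* For K > 0 the neutral element -oo does not affect the maximum. *)
Definition loss (xi : process) : \bar R :=
  (\sum_(t < T) (\big[maxe/-oo%E]_(k < K) l t k (row t xi) : \bar^d R))%dE.

Definition worst_case_expectation : \bar R :=
  ereal_sup [set eexpectation Q loss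
            | Q in wasserstein_ball nrm Xi eps
                     (empirical (xihat : 'I_N -> borelType process))].

Definition feasible (lambda : R) (s : 'I_T -> 'I_N -> R)
    (z nu : 'I_T -> 'I_N -> 'I_K -> 'rV[R]_m) : Prop :=
  (forall i k t,
    (conjugate (fun zeta => - l t k zeta)%E (z t i k - nu t i k)%R
     + support_function (Xi t) (nu t i k)
     - (dotp (z t i k) (row t (xihat i)))%:E <= (s t i)%:E)%dE) /\
  (forall i k t, (dual_norm nrm (z t i k) <= lambda%:E)%E).

Definition program_value : \bar R :=
  ereal_inf [set v | exists lambda s z nu, feasible lambda s z nu /\
    v = (lambda * eps + N%:R^-1 * \sum_(i < N) \sum_(t < T) s t i)%:E].

End separable_loss.

(* Main.v *)
From HB Require Import structures.
Require Import Defs.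
From mathcomp Require Import all_boot all_order all_algebra.
From mathcomp Require Import all_classical all_reals all_analysis.
From mathcomp Require Import measurable_realfun.
From mathcomp Require Import ring lra.

Set Implicit Arguments.
Unset Strict Implicit.
Unset Printing Implicit Defensive.

Import Order.TTheory GRing.Theory Num.Theory.
Import numFieldNormedType.Exports.
Import DualAddTheory.

Local Open Scope classical_set_scope.
Local Open Scope ring_scope.

(** The upper bound is a direct computation.  By the Fenchel-Young
    inequality, a feasible point (lambda, s, z, nu) makes each block of the loss
    at most s t i + lambda * nrm (zeta - row t (xihat i)) on Xi t
    (feasible_majorant).  Hence the loss is dominated on the support by a
    lambda-Lipschitz function whose value at the i-th data point is at most the
    sum over t of s t i, and the integral of such a function increases by at
    most lambda times the transport cost along any coupling
    (eexpectation_loss_le, weak_duality).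

    For the converse only very simple distributions are needed.  A plan moves
    every block of every data point to a point of Xi t where the loss is finite;
    it has an average cost and an average value.  Splitting the mass between two
    plans gives an admissible distribution as soon as the mixed cost is at most
    eps (mixture_le_worst_case, plan_mixture).

    Take a real v above the worst-case expectation.  Two things are shown.

    - If, for one lambda >= 0, all plans satisfy
      value - lambda * (cost - eps) <= v, then the program has value at most v
      (program_value_le).  Both the loss and the cost are sums over the blocks,
      so the supremum over plans is a sum of suprema, which serve as s t i.
      The multipliers z and nu come from separating an epigraph from a point in
      finite dimension (approximate_multipliers).  Since no constraint
      qualification links l t k and Xi t, they exist only up to an arbitrarily
      small error in s t i and in lambda; the infimum of the program absorbs
      this error because lambda and s are free variables.

    - Such a lambda exists, up to the alternative below.  If some plan costs
      less than eps, lambda is the infimum of the slopes of the lines from the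
      plans of cost below eps to the point (eps, v), and comparing it with the
      plans of larger cost uses mixtures of just two plans (planar_duality).

    If no plan costs less than eps (for instance when eps = 0), no multiplier
    need exist.  In that
    case, if every lambda failed, letting lambda go to infinity would give plans
    of cost tending to eps and value above v; they stay in a compact set because
    the loss grows at most linearly, and upper semicontinuity gives a limit plan
    of cost at most eps and value at least v (plan_limit), which contradicts the
    choice of v. *)

(** * Row vectors and separation of convex sets *)

Lemma continuous_subr (R : realType) (V : normedModType R) (z : V) :
  continuous (fun x : V => x - z).
Proof.
move=> x; apply: (@continuousB R V V id (fun=> z) x); first exact: cvg_id.
exact: cst_continuous.
Qed.

Lemma continuous_segment (R : realType) (V : normedModType R) (e : V) (t : R) :
  continuous (fun x : V => x + t *: (e - x)).
Proof.
move=> x; apply: (@continuousD R V V id (fun x => t *: (e - x)) x).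
  exact: cvg_id.
apply: (@continuousZl_tmp R V V (fun x => e - x) t x).
apply: (@continuousB R V V (fun=> e) id x); last exact: cvg_id.
exact: cst_continuous.
Qed.

Section row_vectors.
Context {R : realType} {m : nat}.
Implicit Types (x y z : 'rV[R]_m).

Lemma dotpE x y : dotp x y = \sum_j x 0 j * y 0 j.
Proof. by rewrite /dotp mxE; apply: eq_bigr => j _; rewrite mxE. Qed.

Lemma dotpC x y : dotp x y = dotp y x.
Proof. by rewrite !dotpE; apply: eq_bigr => j _; rewrite mulrC. Qed.

Lemma dotpDl x y z : dotp (x + y) z = dotp x z + dotp y z.
Proof. by rewrite /dotp mulmxDl mxE. Qed.

Lemma dotpDr x y z : dotp z (x + y) = dotp z x + dotp z y.
Proof. by rewrite dotpC dotpDl !(dotpC z). Qed.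

Lemma dotpZl a x z : dotp (a *: x) z = a * dotp x z.
Proof. by rewrite /dotp -scalemxAl mxE. Qed.

Lemma dotpZr a x z : dotp z (a *: x) = a * dotp z x.
Proof. by rewrite dotpC dotpZl dotpC. Qed.

Lemma dotpNl x z : dotp (- x) z = - dotp x z.
Proof. by rewrite -scaleN1r dotpZl mulN1r. Qed.

Lemma dotpNr x z : dotp z (- x) = - dotp z x.
Proof. by rewrite dotpC dotpNl dotpC. Qed.

Lemma dotpBl x y z : dotp (x - y) z = dotp x z - dotp y z.
Proof. by rewrite dotpDl dotpNl. Qed.

Lemma dotpBr x y z : dotp z (x - y) = dotp z x - dotp z y.
Proof. by rewrite dotpDr dotpNr. Qed.

Lemma dotp0r z : dotp z 0 = 0.
Proof. by rewrite -(subrr z) dotpBr subrr. Qed.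

Lemma dotp_ge0 x : 0 <= dotp x x.
Proof. by rewrite dotpE sumr_ge0 // => j _; rewrite -expr2 sqr_ge0. Qed.

Lemma coord_le_norm x j : `|x 0 j| <= `|x|.
Proof.
rewrite [leRHS]/Num.norm /= mx_normrE.
exact: (le_bigmax _ (fun ij : 'I_1 * 'I_m => `|x ij.1 ij.2|) (0, j)).
Qed.

(** The topology of row vectors is that of the maximum norm, whereas projections
    need the inner product; this inequality passes from one to the other. *)
Lemma sqr_norm_le_dotp x : `|x| ^+ 2 <= dotp x x.
Proof.
have [->|x0] := eqVneq `|x| 0; first by rewrite expr0n dotp_ge0.
have [[i j]] := mx_norm_neq0 x0; rewrite /= (ord1 i) => xE.
rewrite [`|x|]xE real_normK ?num_real// dotpE (bigD1 j)//= -expr2 lerDl.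
by apply: sumr_ge0 => k _; rewrite -expr2 sqr_ge0.
Qed.

Lemma sqr_dist_continuous z : continuous (fun x => dotp (x - z) (x - z)).
Proof.
rewrite (_ : (fun x => _) = fun x => \sum_j (x 0 j - z 0 j) * (x 0 j - z 0 j)).
  apply: (continuous_big (@add_continuous R^o)).
  have cj j : continuous (fun x : 'rV[R]_m => x 0 j - z 0 j).
    move=> x; apply: (@continuousB _ R^o _ (fun y => y 0 j) (fun=> z 0 j) x).
      exact: coord_continuous.
    exact: cst_continuous.
  move=> j _ x.
  exact: (@continuousM R _ (fun y => y 0 j - z 0 j) (fun y => y 0 j - z 0 j) x
    (cj j x) (cj j x)).
by apply/funext => x; rewrite dotpE; apply: eq_bigr => j _; rewrite !mxE.
Qed.

Lemma closed_ball_compact (z : 'rV[R]_m) (r : R) : compact [set x | `|x - z| <= r].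
Proof.
apply: bounded_closed_compact.
  exists (r + `|z|); split; first exact: num_real.
  move=> M rM x /= xr; apply/ltW/(le_lt_trans _ rM).
  by rewrite -[x](subrK z) (le_trans (ler_normD _ _))// lerD2r.
apply: (@preimage_closed _ _ (fun x : 'rV[R]_m => `|x - z|) [set t | t <= r]).
  move=> x _ /=; apply: continuous_comp; first exact: continuous_subr.
  exact: norm_continuous.
exact: closed_le.
Qed.

End row_vectors.

Lemma closure_smallest (T : topologicalType) (A B : set T) :
  closed B -> A `<=` B -> closure A `<=` B.
Proof. by move=> cB AB x /(closure_subset AB) => /cB. Qed.

Section separation.
Context {R : realType} {n : nat}.
Implicit Types (E : set 'rV[R]_n) (P e : 'rV[R]_n).

(** It is enough to minimise over a ball around P, which is compact. *)
Lemma nearest_point E P : E !=set0 ->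
  exists2 c, closure E c &
    forall e, closure E e -> dotp (c - P) (c - P) <= dotp (e - P) (e - P).
Proof.
case=> e0 Ee0.
pose D := dotp (e0 - P) (e0 - P).
pose A := closure E `&` [set x | `|x - P| <= D + 1].
have nle x : dotp (x - P) (x - P) <= D -> `|x - P| <= D + 1.
  move=> xD; have h := sqr_norm_le_dotp (x - P).
  have D0 : 0 <= D := dotp_ge0 _.
  rewrite leNgt; apply/negP => lt1.
  have : (D + 1) ^+ 2 < D.
    apply: lt_le_trans (le_trans h xD).
    by rewrite ltr_pXn2r// nnegrE// ?addr_ge0.
  by nra.
have A0 : A !=set0.
  by exists e0; split; [exact: subset_closure|exact: nle].
have cA : compact A.
  apply: subclosed_compact (closed_ball_compact (z := P) (r := D + 1)) _.
    apply: closedI; first exact: closed_closure.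
    by apply: compact_closed; [exact: norm_hausdorff|exact: closed_ball_compact].
  by move=> x [].
have [|c cA' cmin] := @compact_EVT_min _ _
  (fun x : 'rV[R]_n => dotp (x - P) (x - P)) A A0 cA.
  by apply: continuous_subspaceT; exact: sqr_dist_continuous.
have cE : closure E c by move: cA'; rewrite inE => -[].
have eA e : closure E e -> dotp (e - P) (e - P) <= D -> e \in A.
  by move=> Ee eD; rewrite inE; split => //; exact: nle.
exists c => // e Ee.
have [eD|/ltW De] := leP (dotp (e - P) (e - P)) D; first exact/cmin/eA.
by apply: le_trans De; apply: cmin; apply: eA => //; exact: subset_closure.
Qed.

(** With c the point of closure E nearest to P, moving from c towards a point e
    of E does not decrease the distance to P, so c - P and e - c form an angle of
    at most ninety degrees; hence c - P separates. *)
Lemma separation E P (r : R) : E !=set0 -> 0 < r ->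
  (forall x y a, 0 <= a -> a <= 1 -> E x -> E y -> E (a *: x + (1 - a) *: y)) ->
  (forall e, E e -> r <= `|e - P|) ->
  exists q rho, 0 < rho /\ forall e, E e -> dotp q P + rho <= dotp q e.
Proof.
move=> E0 r0 cvxE far.
have [c cE cmin] := nearest_point P E0.
pose q := c - P.
have closure_ge (h : 'rV[R]_n -> R) (a : R) : continuous h ->
    (forall e, E e -> a <= h e) -> forall e, closure E e -> a <= h e.
  move=> hc hE e Ee.
  have cls : closed [set x | a <= h x].
    apply: (@preimage_closed _ _ h [set t | a <= t]); last exact: closed_ge.
    by move=> x _ /=; exact: hc.
  exact: (closure_smallest cls hE Ee).
have qpos : 0 < dotp q q.
  apply: (@lt_le_trans _ _ (r ^+ 2)); first by rewrite exprn_gt0.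
  apply: (closure_ge (fun x : 'rV[R]_n => dotp (x - P) (x - P))) => //.
    exact: sqr_dist_continuous.
  move=> e Ee; apply: le_trans (sqr_norm_le_dotp _).
  by rewrite ler_pXn2r ?nnegrE// ?far// ltW.
exists q, (dotp q q); split => // e Ee.
have seg (t : R) : 0 <= t -> t <= 1 ->
    dotp q q <= dotp (c + t *: (e - c) - P) (c + t *: (e - c) - P).
  move=> t0 t1; apply: cmin.
  have cls : closed [set x | closure E (x + t *: (e - x))].
    apply: (@preimage_closed _ _ (fun x : 'rV[R]_n => x + t *: (e - x)) (closure E)).
      by move=> x _; exact: continuous_segment.
    exact: closed_closure.
  apply: (closure_smallest cls _ cE) => x Ex /=.
  apply: subset_closure.
  have -> : x + t *: (e - x) = t *: e + (1 - t) *: x.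
    by rewrite scalerBr scalerBl scale1r addrCA.
  exact: cvxE.
have key (t : R) : 0 < t -> t <= 1 -> 0 <= 2 * dotp q (e - c) + t * dotp (e - c) (e - c).
  move=> t0 t1; have := seg t (ltW t0) t1.
  have -> : c + t *: (e - c) - P = q + t *: (e - c) by rewrite addrAC.
  move: (q) (e - c) => p d; rewrite !(dotpDl, dotpDr, dotpZl, dotpZr) (dotpC d p) => h.
  have : 0 <= t * (2 * dotp p d + t * dotp d d) by lra.
  by rewrite pmulr_rge0.
have : 0 <= dotp q (e - c).
  rewrite leNgt; apply/negP => neg.
  have D0 : 0 <= dotp (e - c) (e - c) := dotp_ge0 _.
  pose B := dotp (e - c) (e - c) - dotp q (e - c).
  have B0 : 0 < B by rewrite /B; lra.
  (* a step t small enough for the linear term of key to dominate *)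
  have := key (- dotp q (e - c) / B).
  rewrite divr_gt0 ?oppr_gt0// ler_pdivrMr// mul1r => /(_ isT).
  have -> : - dotp q (e - c) <= B by rewrite /B; lra.
  move=> /(_ isT).
  have : (- dotp q (e - c) / B) * dotp (e - c) (e - c) <= - dotp q (e - c).
    rewrite mulrAC ler_pdivrMr// ler_wpM2l ?oppr_ge0 ?ltW// /B; lra.
  lra.
rewrite dotpBr => h.
have -> : dotp q P + dotp q q = dotp q c.
  by rewrite -dotpDr; congr dotp; rewrite /q addrC subrK.
lra.
Qed.

End separation.

(** * Norms and dual norms *)

Section norms.
Context {R : realType} {m : nat}.
Variable nrm : 'rV[R]_m -> R.
Hypothesis nrm_norm : is_norm nrm.
Implicit Types (x y z : 'rV[R]_m).

Lemma nrmD x y : nrm (x + y) <= nrm x + nrm y.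
Proof. by case: nrm_norm. Qed.

Lemma nrmZ a x : nrm (a *: x) = `|a| * nrm x.
Proof. by case: nrm_norm. Qed.

Lemma nrm0 : nrm 0 = 0.
Proof. by rewrite -(scale0r 0) nrmZ normr0 mul0r. Qed.

Lemma nrmN x : nrm (- x) = nrm x.
Proof. by rewrite -scaleN1r nrmZ normrN1 mul1r. Qed.

Lemma nrmB x y : nrm (x - y) = nrm (y - x).
Proof. by rewrite -nrmN opprB. Qed.

Lemma nrm_ge0 x : 0 <= nrm x.
Proof. by have := nrmD x (- x); rewrite subrr nrm0 nrmN; lra. Qed.

Lemma nrm_dist x y z : nrm (x - z) <= nrm (x - y) + nrm (y - z).
Proof. by have := nrmD (x - y) (y - z); rewrite addrA subrK. Qed.

Lemma nrm_convex x y z a : 0 <= a -> a <= 1 ->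
  nrm (a *: x + (1 - a) *: y - z) <= a * nrm (x - z) + (1 - a) * nrm (y - z).
Proof.
move=> a0 a1.
have -> : a *: x + (1 - a) *: y - z = a *: (x - z) + (1 - a) *: (y - z).
  by rewrite !scalerBr addrACA -opprD -scalerDl subrKC scale1r.
apply: le_trans (nrmD _ _) _.
by rewrite !nrmZ (ger0_norm a0) ger0_norm // subr_ge0.
Qed.

Lemma nrm_le_norm : exists2 C, 0 < C & forall x, nrm x <= C * `|x|.
Proof.
exists (1 + \sum_j nrm (delta_mx 0 j)).
  by rewrite ltr_pwDl // sumr_ge0 // => j _; exact: nrm_ge0.
move=> x; rewrite {1}[x]row_sum_delta.
have nrm_sum (F : 'I_m -> 'rV[R]_m) : nrm (\sum_j F j) <= \sum_j nrm (F j).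
  elim/big_ind2 : _ => [|a b c d ab cd|//]; first by rewrite nrm0.
  exact: le_trans (nrmD _ _) (lerD ab cd).
apply: le_trans (nrm_sum _) _.
rewrite mulrDl mul1r mulr_suml ler_wpDl // ler_sum // => j _.
by rewrite nrmZ mulrC ler_wpM2l ?nrm_ge0 // coord_le_norm.
Qed.

Lemma nrm_continuous : continuous nrm.
Proof.
have [C C0 nrmC] := nrm_le_norm.
move=> x; apply/(@cvgrPdist_lt _ _ _ _ (nbhs_filter x)) => e e0.
have eC : 0 < e / C by rewrite divr_gt0.
apply: (filterS _ (nbhsx_ballx x _ eC)) => y.
rewrite -ball_normE /= ltr_pdivlMr // mulrC => xy; apply: le_lt_trans xy.
have h1 := nrmD (x - y) y; have h2 := nrmD (y - x) x.
rewrite !subrK in h1 h2.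
rewrite nrmB in h2.
apply: le_trans (nrmC (x - y)); rewrite ler_norml; lra.
Qed.

Lemma nrm_dist_continuous z : continuous (fun x => nrm (x - z)).
Proof.
move=> x; apply: continuous_comp; first exact: continuous_subr.
exact: nrm_continuous.
Qed.

(** On the unit sphere of the maximum norm, which is compact, nrm has a positive
    minimum. *)
Lemma norm_le_nrm : exists2 c, 0 < c & forall x, `|x| <= c * nrm x.
Proof.
pose S := [set x : 'rV[R]_m | `|x| = 1].
have cS : compact S.
  apply: subclosed_compact (closed_ball_compact (z := 0) (r := 1)) _.
    apply: (@preimage_closed _ _ (fun x : 'rV[R]_m => `|x|) [set t | t = 1]).
      by move=> x _; exact: norm_continuous.
    exact: closed_eq.
  by move=> x /= x1; rewrite subr0 x1.
have [[x0 Sx0]|S0] := pselect (S !=set0); last first.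
  exists 1 => // x; rewrite mul1r; have [->|x0] := eqVneq x 0.
    by rewrite normr0 nrm_ge0.
  exfalso; apply: S0; exists (`|x|^-1 *: x); rewrite /S/=.
  by rewrite normrZ normfV normr_id mulVf// normr_eq0.
have [|x1] := @compact_EVT_min _ _ nrm S (ex_intro _ x0 Sx0) cS.
  by apply: continuous_subspaceT; exact: nrm_continuous.
rewrite inE /S/= => x11 minx.
have x1gt0 : 0 < nrm x1.
  rewrite lt_neqAle nrm_ge0 andbT eq_sym; apply/eqP.
  case: nrm_norm => _ _ def /def x10.
  by move: x11; rewrite x10 normr0 => /eqP; rewrite eq_sym oner_eq0.
exists (nrm x1)^-1; first by rewrite invr_gt0.
move=> x; rewrite mulrC ler_pdivlMr//.
have [->|x0'] := eqVneq x 0; first by rewrite normr0 mul0r nrm_ge0.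
have /minx : `|x|^-1 *: x \in S.
  by rewrite inE /S/= normrZ normfV normr_id mulVf// normr_eq0.
rewrite nrmZ normfV normr_id mulrC ler_pdivlMr ?normr_gt0//.
by rewrite mulrC.
Qed.

Lemma nrm_ball_compact z (M : R) : compact [set x | nrm (x - z) <= M].
Proof.
have [c c0 hc] := norm_le_nrm.
apply: subclosed_compact (closed_ball_compact (z := z) (r := c * M)) _.
  apply: (@preimage_closed _ _ (fun x : 'rV[R]_m => nrm (x - z)) [set t | t <= M]).
    by move=> x _; exact: nrm_dist_continuous.
  exact: closed_le.
by move=> x /= xM; apply: le_trans (hc _) _; rewrite ler_pM2l.
Qed.

Lemma dual_norm_ge (z x : 'rV[R]_m) (lam : R) :
  (dual_norm nrm z <= lam%:E)%E -> dotp z x <= lam * nrm x.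
Proof.
move=> zlam.
have [x0|x0] := eqVneq (nrm x) 0.
  by case: nrm_norm => _ _ /(_ _ x0) ->; rewrite dotp0r nrm0 mulr0.
have x_gt0 : 0 < nrm x by rewrite lt_neqAle eq_sym x0 nrm_ge0.
have : ((dotp z ((nrm x)^-1 *: x))%:E <= lam%:E)%E.
  apply: le_trans zlam; apply: ereal_sup_ubound; exists ((nrm x)^-1 *: x) => //=.
  by rewrite nrmZ normfV ger0_norm ?nrm_ge0// mulVf.
by rewrite lee_fin dotpZr mulrC ler_pdivrMr.
Qed.

Lemma dual_norm_le (z : 'rV[R]_m) (lam : R) : 0 <= lam ->
  (forall x, dotp z x <= lam * nrm x) -> (dual_norm nrm z <= lam%:E)%E.
Proof.
move=> lam0 h; apply: ge_ereal_sup => _ [x /= x1 <-]; rewrite lee_fin.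
by apply: le_trans (h x) _; rewrite ler_piMr.
Qed.

Lemma dual_norm_ge0 (z : 'rV[R]_m) : (0 <= dual_norm nrm z)%E.
Proof.
by apply: ereal_sup_ubound; exists 0; rewrite /= ?nrm0 ?dotp0r.
Qed.

End norms.

(** * Approximate Fenchel duality *)

Lemma norm_row_mxl (R : realType) n1 n2 (a : 'rV[R]_n1) (b : 'rV[R]_n2) :
  `|a| <= `|row_mx a b|.
Proof.
have [->|a0] := eqVneq `|a| 0; first exact: normr_ge0.
have [[i j]] := mx_norm_neq0 a0; rewrite /= (ord1 i) => aE.
rewrite [`|a|]aE -(row_mxEl a b); exact: coord_le_norm.
Qed.

Lemma norm_row_mxr (R : realType) n1 n2 (a : 'rV[R]_n1) (b : 'rV[R]_n2) :
  `|b| <= `|row_mx a b|.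
Proof.
have [->|b0] := eqVneq `|b| 0; first exact: normr_ge0.
have [[i j]] := mx_norm_neq0 b0; rewrite /= (ord1 i) => bE.
rewrite [`|b|]bE -(row_mxEr a b); exact: coord_le_norm.
Qed.

Lemma dotp_row_mx (R : realType) n1 n2 (a c : 'rV[R]_n1) (b d : 'rV[R]_n2) :
  dotp (row_mx a b) (row_mx c d) = dotp a c + dotp b d.
Proof. by rewrite /dotp tr_row_mx mul_row_col mxE. Qed.

Lemma dotp_scalar (R : realType) (a b : R) :
  dotp (a%:M : 'rV_1) (b%:M : 'rV_1) = a * b.
Proof. by rewrite dotpE big_ord1 !mxE eqxx !mulr1n. Qed.

Lemma norm_scalar (R : realType) (a : R) : `|a| <= `|a%:M : 'rV_1|.
Proof.
have := coord_le_norm (a%:M : 'rV_1) ord0.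
by rewrite mxE eqxx mulr1n.
Qed.

Lemma lt_ereal_interpolate (R : realType) (a : R) (e : \bar R) : (a%:E < e)%E ->
  exists2 b, a < b & (b%:E < e)%E.
Proof.
case: e => [r||//].
  rewrite lte_fin => ar; exists ((a + r) / 2); rewrite ?lte_fin; lra.
by move=> _; exists (a + 1); rewrite ?ltry//; lra.
Qed.

Section fenchel.
Context {R : realType} {m : nat}.
Variable nrm : 'rV[R]_m -> R.
Hypothesis nrm_norm : is_norm nrm.
Variables (f : 'rV[R]_m -> \bar R) (Xi : set 'rV[R]_m).
Hypotheses (f_proper : proper_function f) (f_convex : econvex_function f).
Hypothesis f_lsc : lower_semicontinuous f.
Hypotheses (Xi_convex : forall x y (a : R), 0 <= a -> a <= 1 ->
  Xi x -> Xi y -> Xi (a *: x + (1 - a) *: y)) (Xi_closed : closed Xi).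
Implicit Types (x y u z : 'rV[R]_m).

Lemma econvex_epigraph x y (s t a : R) : 0 <= a -> a <= 1 ->
  (f x <= s%:E)%E -> (f y <= t%:E)%E ->
  (f (a *: x + (1 - a) *: y) <= (a * s + (1 - a) * t)%:E)%E.
Proof.
move=> a0 a1 fx fy; apply: le_trans (f_convex x y a0 a1) _.
rewrite (_ : (a * s + (1 - a) * t)%:E = (a%:E * s%:E + (1 - a)%:E * t%:E)%dE)//.
by apply: lee_dD; apply: lee_wpmul2l; rewrite ?lee_fin ?subr_ge0.
Qed.

(** A strict lower bound on f + g over a compact set Y persists, with a uniform
    radius, when f and g are evaluated at two different points near Y. *)
Lemma lsc_uniform (Y : set 'rV[R]_m) (g : 'rV[R]_m -> R) (c : R) :
  compact Y -> continuous g -> (forall y, Y y -> ((c - g y)%:E < f y)%E) ->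
  exists2 r, 0 < r & forall x y u, Y y -> `|x - y| < r -> `|u - y| < r ->
    ((c - g u)%:E < f x)%E.
Proof.
move=> /compact_near_coveringP cY cg hY.
pose P (r : R) y := forall x u, `|x - y| < r -> `|u - y| < r ->
    ((c - g u)%:E < f x)%E.
have : \forall r \near 0^'+, Y `<=` P r.
  apply: cY => y Yy.
  have [b gb bf] := lt_ereal_interpolate (hY y Yy).
  have [V Vy Vf] := f_lsc bf.
  have Wy : nbhs y [set u | c - b < g u].
    have cb : c - b < g y by lra.
    have : nbhs (g y) [set t | c - b < t] by exact: lt_nbhsr.
    exact: cg.
  have [e /= e0 eVW] := (nbhs_ballP y _).1 (filterI Vy Wy).
  have e2 : 0 < e / 2 by lra.
  exists (ball y (e / 2), [set r | r < e / 2]).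
    by split => /=; [exact: nbhsx_ballx|exact: nbhs_right_lt].
  move=> [y' r] /= [yy' re] x u xy' uy'.
  rewrite -ball_normE /= in yy'.
  have near w : `|w - y'| < r -> ball y e w.
    move=> wy'; rewrite -ball_normE /=.
    have := ler_normD (y - y') (y' - w).
    rewrite addrA subrK (distrC y' w); lra.
  have [_ Wu] := eVW _ (near _ uy').
  have [/Vf bx _] := eVW _ (near _ xy').
  by apply: lt_trans bx; rewrite lte_fin; move: Wu => /=; lra.
move=> h.
have [r [rP r0]] : exists r, (Y `<=` P r) /\ 0 < r.
  exact: (@filter_ex _ _ (at_right_proper_filter 0) _
    (filterI h (nbhs_right_gt 0))).
by exists r => // x y u Yy; exact: rP.
Qed.

(** Raising the slope of the penalty from lam to lam + d makes it coercive on
    the points that matter, so that the bound survives small perturbations. *)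
Lemma perturbed_lower_bound (xh x0 : 'rV[R]_m) (t0 lam s d : R) :
  0 <= lam -> 0 < d -> Xi x0 -> f x0 = t0%:E ->
  (forall y, Xi y -> ((- s - lam * nrm (y - xh))%:E <= f y)%E) ->
  exists2 r, 0 < r & forall x y u, Xi y -> `|x - y| < r -> `|u - y| < r ->
    ((- s - d - (lam + d) * nrm (u - xh))%:E < f x)%E.
Proof.
move=> lam0 d0 Xx0 fx0 hf.
pose g u := (lam + d) * nrm (u - xh).
have gc : continuous g.
  move=> u; apply: (@continuousM R _ (fun=> lam + d) (fun u => nrm (u - xh)) u).
    exact: cst_continuous.
  exact: nrm_dist_continuous.
pose F0 := t0 + g x0.
have n0 z : 0 <= nrm z := nrm_ge0 nrm_norm z.
have F0s : 0 <= F0 + s.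
  have := hf _ Xx0; rewrite fx0 lee_fin /F0 /g.
  have := mulr_ge0 (ltW d0) (n0 (x0 - xh)); lra.
(* so far from x0 that the extra slope d alone lifts the bound above F0 *)
pose M := nrm (x0 - xh) + (F0 + s) / d + 1.
have Mge : F0 + s < d * (M - nrm (x0 - xh)).
  rewrite /M (_ : _ - _ = (F0 + s) / d + 1); last by ring.
  by rewrite mulrDr mulrCA divff ?gt_eqF// mulr1; lra.
have M0 : 0 < M.
  have : 0 <= (F0 + s) / d by rewrite divr_ge0// ltW.
  have := n0 (x0 - xh); rewrite /M; lra.
have cY1 : compact (Xi `&` [set y | nrm (y - x0) <= M]).
  apply: subclosed_compact (nrm_ball_compact nrm_norm (z := x0) (M := M)) _.
    apply: closedI => //; apply: compact_closed; first exact: norm_hausdorff.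
    exact: nrm_ball_compact.
  by move=> y [].
have cY2 : compact (Xi `&` [set y | nrm (y - x0) = M]).
  apply: subclosed_compact (nrm_ball_compact nrm_norm (z := x0) (M := M)) _.
    apply: closedI => //.
    apply: (@preimage_closed _ _ (fun x : 'rV[R]_m => nrm (x - x0)) [set t | t = M]).
      by move=> x _; exact: nrm_dist_continuous.
    exact: closed_eq.
  by move=> y [_ /= ->].
have [|r1 r10 h1] := @lsc_uniform _ g (- s - d) cY1 gc.
  move=> y [Xy _]; apply: lt_le_trans (hf y Xy); rewrite lte_fin /g.
  have := mulr_ge0 (ltW d0) (n0 (y - xh)); lra.
have [|r2 r20 h2] := @lsc_uniform _ g F0 cY2 gc.
  move=> y [Xy /= yM]; apply: lt_le_trans (hf y Xy); rewrite lte_fin /g.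
  have := nrm_dist nrm_norm y xh x0; rewrite yM (nrmB nrm_norm xh) => My.
  have : d * (M - nrm (x0 - xh)) <= d * nrm (y - xh) by rewrite ler_pM2l//; lra.
  lra.
exists (Num.min r1 r2); first by rewrite lt_min r10.
move=> x y u Xy; rewrite !lt_min => /andP[xy1 xy2] /andP[uy1 uy2].
have [yM|My] := leP (nrm (y - x0)) M; first exact: (h1 x y u).
(* a distant violation is pulled back by convexity to the sphere of radius M
   around x0, where h2 excludes it *)
rewrite ltNge; apply/negP => fx.
pose a := M / nrm (y - x0).
have ny : 0 < nrm (y - x0) by exact: lt_trans My.
have a0 : 0 < a by rewrite divr_gt0.
have a1 : a <= 1 by rewrite ler_pdivrMr// mul1r ltW.
pose sc w := a *: w + (1 - a) *: x0.
have scB v w : sc v - sc w = a *: (v - w).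
  by rewrite /sc opprD addrACA subrr addr0 scalerBr.
have scx0 : sc x0 = x0 by rewrite /sc -scalerDl subrKC scale1r.
have near v (r : R) : `|v - y| < r -> `|sc v - sc y| < r.
  move=> vy; rewrite scB normrZ gtr0_norm//; apply: le_lt_trans vy.
  by rewrite ler_piMl.
have Ysc : (Xi `&` [set y | nrm (y - x0) = M]) (sc y).
  split; first by apply: Xi_convex => //; exact: ltW.
  rewrite /= -{1}scx0 scB (nrmZ nrm_norm) gtr0_norm// /a -mulrA mulVf ?mulr1//.
  by rewrite gt_eqF.
have := h2 (sc x) (sc y) (sc u) Ysc (near _ _ xy2) (near _ _ uy2).
rewrite ltNge => /negP; apply.
have fx0' : (f x0 <= t0%:E)%E by rewrite fx0.
apply: le_trans (econvex_epigraph (ltW a0) a1 fx fx0') _.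
rewrite lee_fin.
have gsc : g (sc u) <= a * g u + (1 - a) * g x0.
  have := nrm_convex nrm_norm u x0 xh (ltW a0) a1.
  have ld : 0 < lam + d by lra.
  rewrite -(ler_pM2l ld) -/(sc u) -/(g (sc u)) => /le_trans; apply.
  by rewrite /g; lra.
rewrite -/(g u).
have : a * (- s - d) <= a * F0 by rewrite ler_pM2l//; lra.
rewrite /F0; lra.
Qed.

(** Fenchel duality for the sum of f, the indicator of Xi and lam nrm(. - xh).
    The three functions are evaluated at points x, y and u, and the differences
    x - y and u - y perturb the problem.  The perturbed lower bound keeps the
    point (0, 0, - s - d) away from the epigraph of the perturbation function;
    separating them gives the multipliers of x - y and u - y.  Since no
    constraint qualification relates f and Xi, the value and the dual norm are
    only controlled up to an error d. *)
Lemma approximate_multipliers (xh x0 : 'rV[R]_m) (t0 lam s d : R) :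
  0 <= lam -> 0 < d -> Xi x0 -> f x0 = t0%:E ->
  (forall y, Xi y -> ((- s - lam * nrm (y - xh))%:E <= f y)%E) ->
  exists z nu, [/\ (conjugate f (z - nu) + support_function Xi nu
      - (dotp z xh)%:E <= (s + d)%:E)%dE,
    (dual_norm nrm z <= (lam + d)%:E)%E &
    exists c : R, conjugate f (z - nu) = c%:E].
Proof.
move=> lam0 d0 Xx0 fx0 hf.
have d20 : 0 < d / 2 by lra.
have [r r0 hr] := perturbed_lower_bound lam0 d20 Xx0 fx0 hf.
pose g u := (lam + d / 2) * nrm (u - xh).
pose pt x y u (v : R) := row_mx (row_mx (x - y) (u - y)) (v%:M : 'rV[R]_1).
pose E := [set e | exists x y u v,
  [/\ Xi y, (f x <= (v - g u)%:E)%E & e = pt x y u v]].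
(* d / 2 is spent on the slope, the rest keeps P below the epigraph *)
pose P : 'rV[R]_(m + m + 1) := row_mx 0 ((- s - d)%:M : 'rV_1).
have Ex0 v : t0 + g x0 <= v -> E (pt x0 x0 x0 v).
  by move=> tv; exists x0, x0, x0, v; split => //; rewrite fx0 lee_fin; lra.
have E0 : E !=set0 by exists (pt x0 x0 x0 (t0 + g x0)); exact: Ex0.
have r'0 : 0 < Num.min r (d / 2) by rewrite lt_min r0.
have [|e [x [y [u [v [Xy fx ->]]]]]|q [rho [rho0 hq]]] := separation E0 r'0 (P := P).
- move=> e e' a a0 a1 [x [y [u [v [Xy fx ->]]]]] [x' [y' [u' [v' [Xy' fx' ->]]]]].
  exists (a *: x + (1 - a) *: x'), (a *: y + (1 - a) *: y'),
    (a *: u + (1 - a) *: u'), (a * v + (1 - a) * v'); split.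
  + exact: Xi_convex.
  + apply: le_trans (econvex_epigraph a0 a1 fx fx') _; rewrite lee_fin.
    have ld : 0 < lam + d / 2 by lra.
    have := nrm_convex nrm_norm u u' xh a0 a1.
    move=> /(ler_wpM2l (ltW ld)); rewrite /g; lra.
  + rewrite /pt !scale_row_mx !add_row_mx; congr (row_mx (row_mx _ _) _).
    * by rewrite !scalerBr addrACA opprD.
    * by rewrite !scalerBr addrACA opprD.
    * by rewrite !scale_scalar_mx -raddfD.
- have -> : pt x y u v - P = row_mx (row_mx (x - y) (u - y)) (v + s + d)%:M.
    rewrite /pt /P opp_row_mx add_row_mx oppr0 addr0 -raddfN -raddfD.
    by congr (row_mx _ _%:M); ring.
  have [xy|xy] := ltP `|x - y| r; last first.
    by rewrite ge_min (le_trans xy)// (le_trans (norm_row_mxl _ (u - y)))// norm_row_mxl.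
  have [uy|uy] := ltP `|u - y| r; last first.
    by rewrite ge_min (le_trans uy)// (le_trans (norm_row_mxr (x - y) _))// norm_row_mxl.
  have := lt_le_trans (hr x y u Xy xy uy) fx; rewrite lte_fin -/(g u) => vs.
  rewrite ge_min; apply/orP; right; apply: le_trans (norm_row_mxr _ _).
  apply: le_trans (norm_scalar _); rewrite ger0_norm; lra.
(* the three blocks of the separating functional *)
pose q1 := lsubmx (lsubmx q); pose q2 := rsubmx (lsubmx q).
pose tau := rsubmx q 0 0.
have qE : q = row_mx (row_mx q1 q2) tau%:M.
  rewrite /q1 /q2 hsubmxK (_ : tau%:M = rsubmx q) ?hsubmxK//.
  by apply/matrixP => i j; rewrite !ord1 mxE eqxx mulr1n.
have sep x y u v : Xi y -> (f x <= (v - g u)%:E)%E ->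
    tau * (- s - d) + rho <= dotp q1 (x - y) + dotp q2 (u - y) + tau * v.
  move=> Xy fx; have := hq (pt x y u v).
  rewrite qE /P !dotp_row_mx dotp0r add0r !dotp_scalar; apply.
  by exists x, y, u, v.
(* the hyperplane is not vertical: the vertical line over (0, 0) meets E *)
have tau0 : 0 < tau.
  rewrite ltNge; apply/negP => tau_le0.
  pose v := Num.max (t0 + g x0) (- s - d).
  have := @sep x0 x0 x0 v Xx0.
  rewrite subrr !dotp0r fx0 lee_fin => /(_ _)/wrap[|].
    have : t0 + g x0 <= v by rewrite le_max lexx.
    lra.
  have : - s - d <= v by rewrite le_max lexx orbT.
  move=> /(ler_wnM2l tau_le0); lra.
have scale_tau w : w = - tau *: (- tau^-1 *: w).
  by rewrite scalerA mulrNN divff ?scale1r// gt_eqF.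
have [p1 e1] : exists p1, q1 = - tau *: p1
  by exists (- tau^-1 *: q1); exact: scale_tau.
have [p2 e2] : exists p2, q2 = - tau *: p2
  by exists (- tau^-1 *: q2); exact: scale_tau.
have sep' x y u t : Xi y -> (f x <= t%:E)%E ->
    dotp p1 x - t + dotp p2 u - g u + dotp (- (p1 + p2)) y <= s + d.
  move=> Xy fx; have := @sep x y u (t + g u) Xy.
  rewrite addrK => /(_ fx).
  rewrite e1 e2 !dotpZl !dotpBr dotpNl dotpDl => h.
  rewrite -(ler_pM2l tau0); lra.
exists (- p2), (- (p1 + p2)).
have -> : - p2 - - (p1 + p2) = p1 by rewrite opprK addrC addrK.
have conj_le y : Xi y ->
    (conjugate f p1 <= (s + d - dotp p2 xh - dotp (- (p1 + p2)) y)%:E)%E.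
  move=> Xy; apply: ge_ereal_sup => _ [x _ <-].
  case fx : (f x) => [t| |].
  - rewrite lee_fin; have := @sep' x y xh t Xy.
    by rewrite fx lexx => /(_ isT); rewrite /g subrr (nrm0 nrm_norm); lra.
  - by rewrite leNye.
  - by case: f_proper => _ /(_ x); rewrite fx ltxx.
have conj_ge : ((dotp p1 x0 - t0)%:E <= conjugate f p1)%E.
  by apply: ereal_sup_ubound; exists x0 => //; rewrite fx0.
have [c cE] : exists c : R, conjugate f p1 = c%:E.
  have := conj_le _ Xx0; move: conj_ge.
  by case: (conjugate f p1) => [c| |] // _ _; exists c.
split; last by exists c.
- rewrite cE.
  have supp : (support_function Xi (- (p1 + p2)) <= (s + d - dotp p2 xh - c)%:E)%E.
    apply: ge_ereal_sup => _ [y Xy <-].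
    by have := conj_le y Xy; rewrite cE !lee_fin; lra.
  case: (support_function _ _) supp => [v| |].
  + rewrite lee_fin => vle.
    by rewrite (_ : (_ - _)%dE = (c + v - dotp (- p2) xh)%:E)// lee_fin dotpNl; lra.
  + by rewrite leye_eq.
  + by move=> _; exact: leNye.
- apply: dual_norm_le; first lra.
  move=> x; rewrite dotpNl.
  pose B := s + d - (dotp p1 x0 - t0) - dotp (- (p1 + p2)) x0 - dotp p2 xh.
  have key (k : R) : 0 <= k -> k * (- dotp p2 x - (lam + d / 2) * nrm x) <= B.
    move=> k0.
    have := @sep' x0 x0 (xh - k *: x) t0 Xx0.
    rewrite fx0 lexx => /(_ isT).
    rewrite /g [xh - _ - xh]addrAC subrr add0r (nrmN nrm_norm) (nrmZ nrm_norm) ger0_norm//.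
    rewrite dotpBr dotpZr /B; lra.
  have dn : 0 <= d * nrm x := mulr_ge0 (ltW d0) (nrm_ge0 nrm_norm x).
  suff : - dotp p2 x - (lam + d / 2) * nrm x <= 0 by lra.
  set w := _ - _; rewrite leNgt; apply/negP => w0.
  have B0 : 0 <= B by have := key 0 (lexx _); rewrite mul0r.
  have k0 : 0 <= (B + 1) / w by apply: divr_ge0; lra.
  have := key _ k0; rewrite -/w divfK ?gt_eqF//; lra.
Qed.

End fenchel.

(** * Borel measurability on the space of processes *)

Section borel.
Context {R : realType}.

Lemma open_borel_measurable (X : ptopologicalType) (A : set X) :
  open A -> measurable (A : set (borelType X)).
Proof. by move=> oA; apply: sub_gen_smallest. Qed.

Lemma closed_borel_measurable (X : ptopologicalType) (A : set X) :
  closed A -> measurable (A : set (borelType X)).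
Proof.
move=> cA; rewrite -(setCK (A : set (borelType X))); apply: measurableC.
by apply: open_borel_measurable; exact: closed_openC.
Qed.

Lemma continuous_borel_measurable (X Y : ptopologicalType) (f : X -> Y) :
  continuous f -> measurable_fun setT (f : borelType X -> borelType Y).
Proof.
move=> /continuousP cf; apply: (@measurability _ _ (borelType X) (borelType Y) _ _
  (@open Y) erefl).
move=> _ [B oB <-]; rewrite setTI.
by apply: open_borel_measurable; exact: cf.
Qed.

Lemma continuous_real_measurable (X : ptopologicalType) (f : X -> R) :
  continuous f -> measurable_fun setT (f : borelType X -> R).
Proof.
move=> /continuousP cf; apply: (measurability _ (RGenOInfty.measurableE R)).
move=> /= _ [_ [a ->] <-]; rewrite setTI.
by apply: open_borel_measurable; apply: cf; exact: interval_open.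
Qed.

Lemma row_continuous (T m : nat) (t : 'I_T) :
  continuous (fun xi : 'M[R]_(T, m) => row t xi).
Proof.
move=> xi A [P /= hP PA].
exists (fun i j => if i == t then P ord0 j else setT).
  move=> i j; case: eqP => [->|_]; last exact: filterT.
  by have := hP ord0 j; rewrite mxE.
move=> y /= hy; apply: PA => i j; rewrite ord1 mxE.
by have := hy t j; rewrite eqxx.
Qed.

End borel.

Section process_norm.
Context {R : realType} {T m : nat}.
Local Notation process := 'M[R]_(T, m).
Variable nrm : 'rV[R]_m -> R.
Hypothesis nrm_norm : is_norm nrm.
Local Notation N := (process_norm nrm).
Implicit Types x y z : process.

Lemma process_norm_ge0 x : 0 <= N x.
Proof. by apply: sumr_ge0 => t _; exact: nrm_ge0. Qed.

Lemma process_normB x y : N (x - y) = N (y - x).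
Proof. by apply: eq_bigr => t _; rewrite !raddfB/= nrmB. Qed.

Lemma process_norm_dist x y z : N (x - z) <= N (x - y) + N (y - z).
Proof.
rewrite /process_norm -big_split/=; apply: ler_sum => t _.
by rewrite !raddfB/=; exact: nrm_dist.
Qed.

Lemma process_norm_continuous z : continuous (fun x : process => N (x - z)).
Proof.
apply: (continuous_big (@add_continuous R^o)) => t _ x.
apply: continuous_comp; last exact: nrm_continuous.
apply: continuous_comp; first exact: continuous_subr.
exact: row_continuous.
Qed.

Lemma process_norm_le_norm : exists2 C, 0 < C & forall x, N x <= C * `|x|.
Proof.
have [C C0 hC] := nrm_le_norm nrm_norm.
exists (1 + T%:R * C); first by rewrite ltr_pwDl// mulr_ge0// ltW.
move=> x; rewrite mulrDl mul1r; apply: ler_wpDl => //.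
have -> : T%:R * C * `|x| = \sum_(t < T) C * `|x|.
  by rewrite sumr_const card_ord -mulrA mulr_natl.
apply: ler_sum => t _; apply: le_trans (hC _) _; rewrite ler_pM2l//.
have [->|r0] := eqVneq `|row t x| 0; first exact: normr_ge0.
have [[i j]] := mx_norm_neq0 r0; rewrite /= (ord1 i) mxE => rE.
rewrite [`|row t x|]rE [leRHS]/Num.norm /= mx_normrE.
exact: (le_bigmax _ (fun ij : 'I_T * 'I_m => `|x ij.1 ij.2|) (t, j)).
Qed.

Lemma rat_matrix_dense x (e : R) : 0 < e ->
  exists q : 'M[rat]_(T, m), `|x - map_mx ratr q| < e.
Proof.
move=> e0.
have ex (ij : 'I_T * 'I_m) : exists q : rat, `|x ij.1 ij.2 - ratr q| < e.
  have [|q] := @rat_in_itvoo R (x ij.1 ij.2 - e) (x ij.1 ij.2 + e); first lra.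
  by rewrite in_itv/= => /andP[h1 h2]; exists q; rewrite ltr_norml; lra.
have [q hq] := choice ex.
exists (\matrix_(i, j) q (i, j)).
rewrite [ltLHS]/Num.norm /= mx_normrE; apply/bigmax_ltP; split=> // ij _.
by rewrite !mxE; have := hq (ij.1, ij.2).
Qed.

(** Continuity of the distance does not settle the matter, since couplings live
    on the product of two Borel sigma-algebras.  By the triangle inequality,
    N (x - y) < a holds exactly when some rational matrix q and some rational r
    satisfy N (x - q) < r and N (q - y) < a - r, a countable union of
    rectangles. *)
Lemma measurable_process_dist :
  measurable_fun setT (fun p : borelType process * borelType process =>
    N ((p.1 : process) - (p.2 : process))).
Proof.
apply: (measurability _ (RGenInftyO.measurableE R)) => //.
move=> /= _ [_ [a ->] <-]; rewrite setTI.
pose D (q : 'M[rat]_(T, m)) (x : process) := N (x - map_mx ratr q).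
have mD q : measurable_fun setT (D q : borelType process -> R).
  by apply: continuous_real_measurable; exact: process_norm_continuous.
pose F (qr : 'M[rat]_(T, m) * rat) :=
  ((fun p : borelType process * borelType process => D qr.1 p.1) @^-1`
     [set t | t < ratr qr.2]) `&`
  ((fun p : borelType process * borelType process => D qr.1 p.2) @^-1`
     [set t | t < a - ratr qr.2]).
have -> : (fun p : borelType process * borelType process =>
    N ((p.1 : process) - (p.2 : process))) @^-1` `]-oo, a[%classic
    = \bigcup_qr F qr.
  rewrite eqEsubset; split => [[x y] /=|[x y] [[q r] _ [/= h1 h2]]].
    rewrite in_itv/= => xya.
    have [C C0 hC] := process_norm_le_norm.
    pose eta := (a - N (x - y)) / 4.
    have eta0 : 0 < eta by rewrite /eta; lra.
    have [q qx] := rat_matrix_dense x (divr_gt0 eta0 C0).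
    have Dx : D q x < eta.
      by apply: le_lt_trans (hC _) _; rewrite mulrC -ltr_pdivlMr.
    have [|r] := @rat_in_itvoo R eta (2 * eta); first lra.
    rewrite in_itv/= => /andP[r1 r2].
    exists (q, r) => //; split => /=; first exact: lt_trans r1.
    have := process_norm_dist y x (map_mx ratr q).
    rewrite -/(D q y) -/(D q x) process_normB => h.
    have : N (x - y) = a - 4 * eta by rewrite /eta; lra.
    lra.
  rewrite /= in_itv/=; have := process_norm_dist x (map_mx ratr q) y.
  rewrite (process_normB (map_mx ratr q) y) -/(D q x) -/(D q y); lra.
apply: countable_bigcupT_measurable; first exact: countableP.
have mlt (c : R) : measurable [set t : R | t < c].
  by apply: open_measurable; exact: open_lt.
move=> [q r]; apply: measurableI; rewrite -[X in measurable X]setTI.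
  exact: (measurableT_comp (mD q) measurable_fst).
exact: (measurableT_comp (mD q) measurable_snd).
Qed.

End process_norm.

(** * Integrals, expectations and couplings *)

Section probability_of_measure.
Context {d : measure_display} {X : measurableType d} {R : realType}.
Variables (mu : {measure set X -> \bar R}) (mu1 : mu setT = 1%E).

(** A copy of mu whose name records the proof that the total mass is one, so
    that the instance of probability can be attached to it. *)
Definition measure_probability of mu setT = 1%E : set X -> \bar R := mu.

Local Notation Q := (measure_probability mu1).

HB.instance Definition _ := Measure.on Q.

HB.instance Definition _ := Measure_isProbability.Build _ _ _ Q mu1.

Lemma probability_of_measure : exists P : probability X R, forall A, P A = mu A.
Proof. by exists Q. Qed.

End probability_of_measure.

Section integrals.
Context {d : measure_display} {X : measurableType d} {R : realType}.
Local Open Scope ereal_scope.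

Lemma ge0_integral_empirical (N : nat) (x : 'I_N.+1 -> X) (f : X -> \bar R) :
  measurable_fun setT f -> (forall y, 0 <= f y) ->
  \int[empirical x]_y f y = (N.+1%:R^-1)%:E * \sum_(i < N.+1) f (x i).
Proof.
move=> mf f0.
have iN : (0 <= N.+1%:R^-1 :> R)%R by rewrite invr_ge0.
rewrite (@eq_measure_integral _ _ _ setT (mscale (NngNum iN)
    (msum (fun k => dirac (x (inord k))) N.+1))); last first.
  move=> A mA _; rewrite /empirical /mscale /msum /=; congr (_ * _).
  by apply: eq_bigr => i _; rewrite inord_val.
rewrite ge0_integral_mscale// ge0_integral_measure_sum//; congr (_ * _).
by apply: eq_bigr => i _; rewrite integral_dirac// diracT mul1e inord_val.
Qed.

Lemma integral_mine0 (mu : {measure set X -> \bar R}) (f : X -> \bar R) :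
  \int[mu]_x mine (f x) 0 = - \int[mu]_x maxe (- f x) 0.
Proof.
rewrite -integral_ge0N; last by move=> x _; rewrite le_max lexx orbT.
by apply: eq_integral => x _; rewrite -[RHS]oppeK !oppe_max ?oppeK ?oppe0.
Qed.

(** Both integrals are monotone, so the convention for infinite integrals of
    opposite signs need not be examined. *)
Lemma eexpectation_le (Q : probability X R) (D : set X) (f g : X -> \bar R) :
  measurable D -> Q D = 1 -> measurable_fun setT f -> measurable_fun setT g ->
  (forall x, D x -> f x <= g x) -> eexpectation Q f <= eexpectation Q g.
Proof.
move=> mD QD mf mg fg.
have ae : {ae Q, forall x, D x}.
  exists (~` D); split => //; first exact: measurableC.
  by rewrite probability_setC// QD subee.
rewrite /eexpectation; apply: lee_dD.
  apply: ae_ge0_le_integral => //.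
  - by move=> x _; rewrite le_max lexx orbT.
  - by apply: measurable_maxe.
  - by move=> x _; rewrite le_max lexx orbT.
  - by apply: measurable_maxe.
  - apply: filterS ae => x Dx _; rewrite ge_max !le_max lexx orbT andbT.
    by rewrite fg.
rewrite !integral_mine0 leeN2; apply: ae_ge0_le_integral => //.
- by move=> x _; rewrite le_max lexx orbT.
- by apply: measurable_maxe => //; exact: measurableT_comp.
- by move=> x _; rewrite le_max lexx orbT.
- by apply: measurable_maxe => //; exact: measurableT_comp.
- apply: filterS ae => x Dx _; rewrite ge_max !le_max lexx orbT andbT.
  by rewrite leeN2 fg.
Qed.

(** For h = H + b, integrating the identity max (h, 0) - b = H + max (- h, 0)
    between nonnegative functions avoids any assumption of integrability. *)
Lemma eexpectation_shift (Q : probability X R) (H : X -> R) (b : R) :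
  (b <= 0)%R -> (forall x, 0 <= H x)%R -> measurable_fun setT H ->
  eexpectation Q (fun x => (H x + b)%:E) <= \int[Q]_x (H x)%:E + b%:E.
Proof.
move=> b0 H0 mH.
have mH' : measurable_fun setT (fun x => (H x)%:E) by exact/measurable_EFinP.
have mHb : measurable_fun setT (fun x => (H x + b)%:E).
  by apply/measurable_EFinP; apply: measurable_funD.
have nb0 : 0 <= (- b)%:E by rewrite lee_fin; lra.
rewrite /eexpectation integral_mine0.
set A := \int[Q]_x maxe _ _; set B := \int[Q]_x maxe _ _.
have mA : measurable_fun setT (fun x => maxe (H x + b)%:E 0).
  exact: measurable_maxe.
have mB : measurable_fun setT (fun x => maxe (- (H x + b)%:E) 0).
  by apply: measurable_maxe => //; exact: measurableT_comp.
have A0 : 0 <= A by apply: integral_ge0 => x _; rewrite le_max lexx orbT.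
have B0 : 0 <= B by apply: integral_ge0 => x _; rewrite le_max lexx orbT.
have cstb : \int[Q]_x (- b)%:E = (- b)%:E.
  rewrite (integral_cst Q measurableT) -[RHS]mule1; congr (_ * _).
  exact: probability_setT.
have Bfin : B <= (- b)%:E.
  rewrite -cstb; apply: ge0_le_integral => //.
  - by move=> x _; rewrite le_max lexx orbT.
  - move=> x _; rewrite -EFinN ge_max !lee_fin; have := H0 x.
    by move=> Hx; apply/andP; split; lra.
have AB : A + (- b)%:E = \int[Q]_x (H x)%:E + B.
  have ge0 (g : X -> \bar R) x : 0 <= maxe (g x) 0 by rewrite le_max lexx orbT.
  have H0' x : 0 <= (H x)%:E by rewrite lee_fin.
  have h1 : \int[Q]_x maxe (H x + b)%:E 0 + \int[Q]_x (- b)%:E =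
      \int[Q]_x (maxe (H x + b)%:E 0 + (- b)%:E).
    by rewrite ge0_integralD// => x _; exact: (ge0 (fun x => (H x + b)%:E)).
  have h2 : \int[Q]_x (H x)%:E + \int[Q]_x maxe (- (H x + b)%:E) 0 =
      \int[Q]_x ((H x)%:E + maxe (- (H x + b)%:E) 0).
    by rewrite ge0_integralD// => x _; exact: (ge0 (fun x => - (H x + b)%:E)).
  rewrite /A /B -cstb h1 h2.
  apply: eq_integral => x _; rewrite -EFinN -!EFin_max -!EFinD; congr EFin.
  by rewrite /Num.max; case: ifPn; case: ifPn; rewrite -?leNgt => ? ?; lra.
case: B B0 Bfin AB => [B| |]//.
rewrite !lee_fin => B0 Bb.
case: A A0 => [A| |]// A0; case: (\int[Q]_x _) => [I| |]//= [].
by move=> AB; rewrite lee_fin; lra.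
Qed.

End integrals.

Section couplings.
Context {d : measure_display} {X : measurableType d} {R : realType}.
Variables (P Q : {measure set X -> \bar R}) (Pi : probability (X * X)%type R).
Hypothesis PiPQ : coupling P Q Pi.
Local Open Scope ereal_scope.

Lemma ge0_integral_coupling_fst (f : X -> \bar R) :
  measurable_fun setT f -> (forall x, 0 <= f x) ->
  \int[Pi]_p f p.1 = \int[P]_x f x.
Proof.
move=> mf f0.
rewrite -(@eq_measure_integral _ _ _ setT P (pushforward Pi (fst : X * X -> X))).
  by rewrite ge0_integral_pushforward.
move=> A mA _; have [<- _] := PiPQ mA.
by rewrite /pushforward; congr (Pi _); rewrite eqEsubset; split => [[a b]|[a b]] //= [].
Qed.

Lemma ge0_integral_coupling_snd (f : X -> \bar R) :
  measurable_fun setT f -> (forall x, 0 <= f x) ->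
  \int[Pi]_p f p.2 = \int[Q]_x f x.
Proof.
move=> mf f0.
rewrite -(@eq_measure_integral _ _ _ setT Q (pushforward Pi (snd : X * X -> X))).
  by rewrite ge0_integral_pushforward.
move=> A mA _; have [_ <-] := PiPQ mA.
by rewrite /pushforward; congr (Pi _); rewrite eqEsubset; split => [[a b]|[a b]] //= [].
Qed.

Lemma coupling_full (D : set X) :
  measurable D -> P D = 1 -> Q D = 1 -> Pi (D `*` D) = 1.
Proof.
move=> mD PD QD; have [P1 Q1] := PiPQ mD.
have m1 : measurable (D `*` [set: X]) by exact: measurableX.
have m2 : measurable ([set: X] `*` D) by exact: measurableX.
have -> : D `*` D = ~` (~` (D `*` setT) `|` ~` (setT `*` D)).
  by rewrite setCU !setCK; rewrite eqEsubset; split => [[a b]|[a b]] /=;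
    [move=> []|move=> [[] ? _ [] _ ?]].
rewrite probability_setC; last first.
  by apply: measurableU; exact: measurableC.
rewrite (_ : Pi (_ `|` _) = 0) ?sube0//.
apply/eqP; rewrite eq_le measure_ge0 andbT.
apply: le_trans (measureU2 Pi (measurableC m1) (measurableC m2)) _.
have c1 : Pi (~` (D `*` [set: X])) = 0 by rewrite probability_setC// P1 PD subee.
have c2 : Pi (~` ([set: X] `*` D)) = 0 by rewrite probability_setC// Q1 QD subee.
by move: c1 c2 => /= -> ->; rewrite adde0.
Qed.

End couplings.

(** * Weak duality *)

Lemma empirical_full (d : measure_display) (X : measurableType d) (R : realType)
    (N : nat) (x : 'I_N.+1 -> X) (A : set X) :
  (forall i, A (x i)) -> empirical x A = 1%E :> \bar R.
Proof.
move=> Ax; rewrite /empirical (eq_bigr (fun=> 1%E)); last first.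
  by move=> i _; rewrite diracE mem_set.
rewrite sumEFin -EFinM big_const_ord iter_addr_0 mulVf//.
Qed.

Lemma integral_full (d : measure_display) (X : measurableType d) (R : realType)
    (Q : probability X R) (D : set X) (f : X -> \bar R) :
  measurable D -> Q D = 1%E -> measurable_fun setT f -> (forall x, 0 <= f x)%E ->
  (\int[Q]_x f x = \int[Q]_(x in D) f x)%E.
Proof.
move=> mD QD mf f0.
have Q0 : Q (~` D) = 0%E by rewrite probability_setC// QD subee.
rewrite (@ge0_negligible_integral _ _ _ _ _ (~` D))//.
- by rewrite setTD setCK.
- exact: measurableC.
Qed.

Section measurable_dual.
Context {d : measure_display} {X : measurableType d} {R : realType}.

Lemma measurable_dual_add (f g : X -> \bar R) :
  measurable_fun setT f -> measurable_fun setT g ->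
  measurable_fun setT (fun x => (f x + g x)%dE).
Proof.
move=> mf mg; under eq_fun do rewrite dual_addeE.
apply: measurableT_comp; first exact: oppe_measurable.
by apply: emeasurable_funD; apply: measurableT_comp => //; exact: oppe_measurable.
Qed.

Lemma measurable_dual_sum (I : Type) (s : seq I) (f : I -> X -> \bar R) :
  (forall i, measurable_fun setT (f i)) ->
  measurable_fun setT (fun x => (\sum_(i <- s) (f i x : \bar^d R))%dE : \bar R).
Proof.
move=> mf; elim: s => [|i s IH]; under eq_fun do rewrite ?big_nil ?big_cons.
  exact: measurable_cst.
exact: measurable_dual_add.
Qed.

Lemma measurable_bigmaxe (I : Type) (s : seq I) (f : I -> X -> \bar R) :
  (forall i, measurable_fun setT (f i)) ->
  measurable_fun setT (fun x => \big[maxe/-oo%E]_(i <- s) f i x).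
Proof.
move=> mf; elim: s => [|i s IH]; under eq_fun do rewrite ?big_nil ?big_cons.
  exact: measurable_cst.
exact: measurable_maxe.
Qed.

Lemma measurable_bigminr (I : Type) (s : seq I) (x0 : X -> R) (f : I -> X -> R) :
  measurable_fun setT x0 -> (forall i, measurable_fun setT (f i)) ->
  measurable_fun setT (fun x => \big[Num.min/x0 x]_(i <- s) f i x).
Proof.
move=> m0 mf; elim: s => [|i s IH]; under eq_fun do rewrite ?big_nil ?big_cons.
  exact: m0.
exact: measurable_minr.
Qed.

End measurable_dual.

Section process_measurability.
Context {R : realType} {T m K : nat}.
Local Notation process := 'M[R]_(T, m).
Variables (Xi : 'I_T -> set 'rV[R]_m) (l : 'I_T -> 'I_K -> 'rV[R]_m -> \bar R).

Lemma measurable_process_set : (forall t, closed (Xi t)) ->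
  measurable (process_set Xi : set (borelType process)).
Proof.
move=> cXi; apply: closed_borel_measurable.
have -> : process_set Xi = \bigcap_t ((fun xi : process => row t xi) @^-1` Xi t).
  by rewrite eqEsubset; split => [xi h t _|xi h t]; [exact: h|exact: h].
apply: closed_bigI => t _; apply: preimage_closed; last exact: cXi.
by move=> xi _; exact: row_continuous.
Qed.

Lemma measurable_loss :
  (forall t k, measurable_fun setT (l t k : borelType 'rV[R]_m -> \bar R)) ->
  measurable_fun setT (loss l : borelType process -> \bar R).
Proof.
move=> ml; apply: measurable_dual_sum => t; apply: measurable_bigmaxe => k.
apply: (measurableT_comp (ml t k)).
by apply: continuous_borel_measurable; exact: row_continuous.
Qed.

End process_measurability.

Section weak_duality.
Context {R : realType} {T m K N : nat}.
Local Notation process := 'M[R]_(T, m).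
Variables (nrm : 'rV[R]_m -> R) (Xi : 'I_T -> set 'rV[R]_m).
Variable l : 'I_T -> 'I_K -> 'rV[R]_m -> \bar R.
Variables (xihat : 'I_N.+1 -> process) (eps : R).
Hypothesis nrm_norm : is_norm nrm.
Hypothesis Xi_closed : forall t, closed (Xi t).
Hypothesis xihat_in : forall i, process_set Xi (xihat i).
Hypothesis l_measurable :
  forall t k, measurable_fun setT (l t k : borelType 'rV[R]_m -> \bar R).
Variables (lambda : R) (s : 'I_T -> 'I_N.+1 -> R).
Variables (z nu : 'I_T -> 'I_N.+1 -> 'I_K -> 'rV[R]_m).
Hypothesis feas : feasible nrm Xi l xihat lambda s z nu.
Hypothesis lambda_ge0 : 0 <= lambda.

(** Fenchel-Young applied to - l t k at z - nu and to the support function at nu;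
    the vectors nu cancel and the dual norm of z is at most lambda. *)
Lemma feasible_majorant t i k (zeta : 'rV[R]_m) : Xi t zeta ->
  (l t k zeta <= (s t i + lambda * nrm (zeta - row t (xihat i)))%:E)%E.
Proof.
move=> Xz; case: feas => /(_ i k t) h1 /(_ i k t) h2.
have c1 : ((dotp (z t i k - nu t i k) zeta)%:E - - l t k zeta <=
    conjugate (fun x => - l t k x) (z t i k - nu t i k)%R)%E.
  by apply: ereal_sup_ubound; exists zeta.
have c2 : ((dotp (nu t i k) zeta)%:E <= support_function (Xi t) (nu t i k))%E.
  by apply: ereal_sup_ubound; exists zeta.
have := le_trans (lee_dD2r (- (dotp (z t i k) (row t (xihat i)))%:E)%E
  (lee_dD c1 c2)) h1.
case: (l t k zeta) => [r| |].
- have := dual_norm_ge nrm_norm (row t (xihat i) - zeta) h2.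
  rewrite (nrmB nrm_norm) dotpBr dotpBl => h3.
  by rewrite !lee_fin; lra.
- by rewrite leye_eq.
- by move=> _; exact: leNye.
Qed.

Lemma loss_majorant i (xi : process) : (0 < K)%N -> process_set Xi xi ->
  (loss l xi <= ((\sum_t s t i) + lambda * process_norm nrm (xi - xihat i))%:E)%E.
Proof.
move=> K0 Xxi.
rewrite /process_norm mulr_sumr -big_split /= -dsumEFin.
apply: lee_dsum => t _; apply/bigmax_leP; split; first exact: leNye.
move=> k _; rewrite raddfB /=; exact: feasible_majorant.
Qed.

Let h i (xi : process) := (\sum_t s t i) + lambda * process_norm nrm (xi - xihat i).

(** The largest lambda-Lipschitz function that is at most the sum of the s t i
    at each data point; it dominates the loss on the support. *)
Let G (xi : process) := \big[Num.min/h ord0 xi]_(i < N.+1) h i xi.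

Let b : R := - \sum_i `|\sum_t s t i|.

Let G_le i xi : G xi <= h i xi.
Proof. exact: bigmin_le_cond. Qed.

Let G_ge (a : R) xi : (forall i, a <= h i xi) -> a <= G xi.
Proof. by move=> ah; apply/bigmin_geP; split. Qed.

Let b_le xi : b <= G xi.
Proof.
apply: G_ge => i; rewrite /h /b (bigD1 i)//=.
have h1 : 0 <= lambda * process_norm nrm (xi - xihat i).
  by rewrite mulr_ge0// process_norm_ge0.
have h2 : 0 <= \sum_(j < N.+1 | j != i) `|\sum_t s t j| by apply: sumr_ge0.
have := ler_norm (- \sum_t s t i); rewrite normrN; lra.
Qed.

Let G_lipschitz x y : G y <= G x + lambda * process_norm nrm (x - y).
Proof.
rewrite -lerBlDr; apply: G_ge => i; rewrite lerBlDr.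
apply: le_trans (G_le i y) _; rewrite /h -addrA lerD2l -mulrDr ler_wpM2l//.
rewrite [leRHS]addrC (process_normB nrm_norm x); exact: process_norm_dist.
Qed.

Let measurable_G : measurable_fun setT (G : borelType process -> R).
Proof.
have mh i : measurable_fun setT (h i : borelType process -> R).
  apply: measurable_funD; first exact: measurable_cst.
  apply: measurable_funM; first exact: measurable_cst.
  by apply: continuous_real_measurable; exact: process_norm_continuous.
exact: measurable_bigminr.
Qed.

Local Open Scope ereal_scope.

(** The majorant G changes by at most lambda times the distance along a coupling.
    Subtracting the lower bound b makes every integrand nonnegative. *)
Lemma eexpectation_loss_le (Q : probability (borelType process) R) (Pi : probability _ R) :
  (0 < K)%N -> Q (process_set Xi) = 1 ->
  coupling (empirical (xihat : 'I_N.+1 -> borelType process)) Q Pi ->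
  eexpectation Q (loss l) <=
    lambda%:E * \int[Pi]_(p in process_set Xi `*` process_set Xi)
      (process_norm nrm ((p.1 : process) - (p.2 : process)))%:E +
    (N.+1%:R^-1 * \sum_i \sum_t s t i)%:E.
Proof.
move=> K0 QXi PiP.
pose H (xi : borelType process) := (G xi - b)%R.
have H0 xi : (0 <= H xi)%R by rewrite subr_ge0.
have mH : measurable_fun setT H.
  by apply: measurable_funD => //; exact: measurable_cst.
have mHE : measurable_fun setT (fun xi => (H xi)%:E) by exact/measurable_EFinP.
have mXi := measurable_process_set Xi_closed.
have mloss := measurable_loss l_measurable.
have b0 : (b <= 0)%R by rewrite /b oppr_le0; apply: sumr_ge0.
have step1 : eexpectation Q (loss l) <= eexpectation Q (fun xi => (H xi + b)%:E).
  apply: (eexpectation_le mXi QXi) => //.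
    by apply/measurable_EFinP; apply: measurable_funD => //; exact: measurable_cst.
  move=> xi Xxi; rewrite /H subrK.
  have lle i : loss l xi <= (h i xi)%:E by exact: loss_majorant.
  case: (loss l xi) lle => [r| |] lle; last exact: leNye.
    by rewrite lee_fin; apply: G_ge => i; rewrite -lee_fin.
  by have := lle ord0; rewrite leNgt ltry.
apply: le_trans step1 _; apply: le_trans (eexpectation_shift _ b0 H0 mH) _.
pose c (p : borelType process * borelType process) :=
  process_norm nrm ((p.1 : process) - (p.2 : process)).
have c0 p : (0 <= c p)%R by exact: process_norm_ge0.
have mc : measurable_fun setT (fun p => (c p)%:E).
  by apply/measurable_EFinP; exact: measurable_process_dist.
pose D := process_set Xi `*` process_set Xi : set (borelType process * borelType process).
have mD : measurable D by exact: measurableX.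
have PXi : empirical (xihat : 'I_N.+1 -> borelType process) (process_set Xi) = 1 :> \bar R.
  exact: empirical_full.
have PiD : Pi D = 1 by exact: (coupling_full PiP mXi).
have HE0 xi : 0 <= (H xi)%:E by rewrite lee_fin.
have c0' p : 0 <= (c p)%:E by rewrite lee_fin.
have mfst : measurable_fun setT
    (fun p : borelType process * borelType process => (H p.1)%:E).
  exact: (measurableT_comp mHE measurable_fst).
have msnd : measurable_fun setT
    (fun p : borelType process * borelType process => (H p.2)%:E).
  exact: (measurableT_comp mHE measurable_snd).
have mlc : measurable_fun setT (fun p => lambda%:E * (c p)%:E).
  exact: measurable_funeM.
have lc0 p : 0 <= lambda%:E * (c p)%:E by rewrite mule_ge0 ?lee_fin.
have step2 : \int[Q]_xi (H xi)%:E <= \int[Pi]_(p in D) ((H p.1)%:E + lambda%:E * (c p)%:E).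
  rewrite -(ge0_integral_coupling_snd PiP mHE HE0) (integral_full mD PiD)//.
  apply: ge0_le_integral => //.
  - exact: measurable_funTS.
  - by apply: emeasurable_funD; exact: measurable_funTS.
  - move=> [x y] _; rewrite -EFinM -EFinD lee_fin /H /c/=.
    by have := G_lipschitz x y; lra.
have step3 : \int[Pi]_(p in D) (H p.1)%:E <=
    (N.+1%:R^-1 * (\sum_i \sum_t s t i) - b)%:E.
  apply: (@le_trans _ _ (\int[Pi]_p (H p.1)%:E)).
    exact: ge0_subset_integral.
  rewrite (ge0_integral_coupling_fst PiP mHE HE0).
  rewrite ge0_integral_empirical// sumEFin -EFinM lee_fin.
  have avg (a : R) : (a = N.+1%:R^-1 * \sum_(i < N.+1) a)%R.
    by rewrite sumr_const card_ord -[(a *+ _)%R]mulr_natl mulrA mulVf ?mul1r.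
  rewrite [X in (_ - X)%R]avg.
  rewrite -mulrBr ler_wpM2l ?invr_ge0// -sumrB; apply: ler_sum => i _.
  rewrite lerD2r; apply: le_trans (G_le i _) _.
  have N0 : process_norm nrm (0 : process) = 0%R.
    by apply: big1 => t _; rewrite raddf0 (nrm0 nrm_norm).
  by rewrite /h subrr N0 mulr0 addr0.
apply: le_trans (leeD2r _ step2) _.
rewrite ge0_integralD//; [|exact: measurable_funTS|exact: measurable_funTS].
rewrite ge0_integralZl//; [|exact: measurable_funTS].
set I := \int[Pi]_(p in D) (c p)%:E.
apply: le_trans (leeD2r _ (leeD2r _ step3)) _.
rewrite addeAC -EFinD subrK addeC; exact: lexx.
Qed.

End weak_duality.

Section mixtures.
Context {d : measure_display} {X : measurableType d} {R : realType}.
Local Open Scope ereal_scope.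

Lemma mixture_probability (N : nat) (x1 x2 : 'I_N.+1 -> X) (th : R) :
  (0 <= th)%R -> (th <= 1)%R ->
  exists Q : probability X R,
    (forall A, Q A = th%:E * empirical x1 A + (1 - th)%:E * empirical x2 A) /\
    (forall f, measurable_fun setT f -> (forall x, 0 <= f x) ->
       \int[Q]_x f x = th%:E * ((N.+1%:R^-1)%:E * \sum_i f (x1 i)) +
         (1 - th)%:E * ((N.+1%:R^-1)%:E * \sum_i f (x2 i))).
Proof.
move=> th0 th1; have th1' : (0 <= 1 - th)%R by rewrite subr_ge0.
pose mu : {measure set X -> \bar R} := measure_add (mscale (NngNum th0) (empirical x1))
  (mscale (NngNum th1') (empirical x2)).
have muE A : mu A = th%:E * empirical x1 A + (1 - th)%:E * empirical x2 A.
  exact: measure_addE.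
have mu1 : mu setT = 1.
  by rewrite muE !empirical_full// !mule1 -EFinD subrKC.
have [Q QE] := probability_of_measure mu1.
exists Q; split => [A|f mf f0]; first by rewrite QE muE.
rewrite (@eq_measure_integral _ _ _ setT mu); last by move=> A _ _; exact: QE.
rewrite ge0_integral_measure_add// !ge0_integral_mscale//.
by rewrite !ge0_integral_empirical.
Qed.

End mixtures.

Section weak_duality_theorem.
Context {R : realType} {T m K N : nat}.
Local Notation process := 'M[R]_(T, m).
Variables (nrm : 'rV[R]_m -> R) (Xi : 'I_T -> set 'rV[R]_m).
Variable l : 'I_T -> 'I_K -> 'rV[R]_m -> \bar R.
Variables (xihat : 'I_N.+1 -> process) (eps : R).
Hypothesis nrm_norm : is_norm nrm.
Hypothesis Xi_closed : forall t, closed (Xi t).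
Hypothesis xihat_in : forall i, process_set Xi (xihat i).
Hypothesis l_measurable :
  forall t k, measurable_fun setT (l t k : borelType 'rV[R]_m -> \bar R).
Local Open Scope ereal_scope.

Theorem weak_duality : (0 < T)%N -> (0 < K)%N ->
  worst_case_expectation nrm Xi l xihat eps <= program_value nrm Xi l xihat eps.
Proof.
move=> T0 K0.
apply: ge_ereal_sup => _ [Q [[QXi _] WQ] <-].
apply: le_ereal_inf_tmp => _ [lam [s [z [nu [feas ->]]]]].
have lam0 : (0 <= lam)%R.
  case: feas => _ /(_ ord0 (Ordinal K0) (Ordinal T0)).
  by move=> /(le_trans (dual_norm_ge0 nrm_norm _)); rewrite lee_fin.
apply/lee_addgt0Pr => e e0.
pose dl := (e / (lam + 1))%R.
have lam1 : (0 < lam + 1)%R by lra.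
have dl0 : (0 < dl)%R by rewrite divr_gt0.
have : wasserstein nrm Xi (empirical (xihat : 'I_N.+1 -> borelType process)) Q
    < (eps + dl)%:E.
  by apply: le_lt_trans WQ _; rewrite lte_fin; lra.
move=> /ereal_inf_lt [_ [Pi PiP <-] cost].
apply: le_trans (eexpectation_loss_le nrm_norm Xi_closed xihat_in l_measurable
  feas lam0 K0 QXi PiP) _.
have : lam%:E * \int[Pi]_(p in process_set Xi `*` process_set Xi)
      (process_norm nrm ((p.1 : process) - (p.2 : process)))%:E <=
    lam%:E * (eps + dl)%:E.
  by apply: lee_wpmul2l; [rewrite lee_fin|exact: ltW].
move=> /(leeD2r (N.+1%:R^-1 * \sum_i \sum_t s t i)%:E) /le_trans; apply.
rewrite -EFinM -!EFinD lee_fin.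
have : (lam * dl <= e)%R.
  by rewrite /dl mulrCA ler_piMr ?(ltW e0)// ler_pdivrMr//; lra.
by rewrite mulrDr -!addrA lerD2l addrC lerD2l.
Qed.

End weak_duality_theorem.

Section mixture_lower_bound.
Context {R : realType} {T m K N : nat}.
Local Notation process := 'M[R]_(T, m).
Variables (nrm : 'rV[R]_m -> R) (Xi : 'I_T -> set 'rV[R]_m).
Variable l : 'I_T -> 'I_K -> 'rV[R]_m -> \bar R.
Variables (xihat : 'I_N.+1 -> process) (eps : R).
Hypothesis nrm_norm : is_norm nrm.
Hypothesis Xi_closed : forall t, closed (Xi t).
Hypothesis l_measurable :
  forall t k, measurable_fun setT (l t k : borelType 'rV[R]_m -> \bar R).
Local Notation avg w := (N.+1%:R^-1 * \sum_(i < N.+1) w i).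

(** The distribution splits the mass of every data point between two
    destinations; the corresponding coupling has the cost that is bounded by eps,
    and expectations under it are finite sums. *)
Lemma mixture_le_worst_case (x1 x2 : 'I_N.+1 -> process) (w1 w2 : 'I_N.+1 -> R) (th : R) :
  0 <= th -> th <= 1 ->
  (forall i, process_set Xi (x1 i)) -> (forall i, process_set Xi (x2 i)) ->
  (forall i, loss l (x1 i) = (w1 i)%:E) -> (forall i, loss l (x2 i) = (w2 i)%:E) ->
  th * avg (fun i => process_norm nrm (xihat i - x1 i)) +
    (1 - th) * avg (fun i => process_norm nrm (xihat i - x2 i)) <= eps ->
  ((th * avg w1 + (1 - th) * avg w2)%:E <= worst_case_expectation nrm Xi l xihat eps)%E.
Proof.
move=> th0 th1 Xx1 Xx2 lx1 lx2 cost.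
have mXi := measurable_process_set Xi_closed.
have mloss := measurable_loss l_measurable.
have [Q [QE QI]] := mixture_probability (x1 : 'I_N.+1 -> borelType process)
  (x2 : 'I_N.+1 -> borelType process) th0 th1.
pose xh : 'I_N.+1 -> borelType process := xihat.
have [Pi [PiE PiI]] := mixture_probability
  (fun i => (xh i, x1 i : borelType process))
  (fun i => (xh i, x2 i : borelType process)) th0 th1.
have real_comb (f : process -> \bar R) (r1 r2 : 'I_N.+1 -> R) :
    (forall i, f (x1 i) = (r1 i)%:E) -> (forall i, f (x2 i) = (r2 i)%:E) ->
    (th%:E * ((N.+1%:R^-1)%:E * \sum_i f (x1 i)) +
      (1 - th)%:E * ((N.+1%:R^-1)%:E * \sum_i f (x2 i)))%E
    = (th * avg r1 + (1 - th) * avg r2)%:E.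
  move=> h1 h2; rewrite (eq_bigr (fun i => (r1 i)%:E)) => [|i _]; last exact: h1.
  rewrite [X in (_ + _ * (_ * X))%E](eq_bigr (fun i => (r2 i)%:E)) => [|i _];
    last exact: h2.
  by rewrite !sumEFin -!EFinM -EFinD.
have Qmax : (\int[Q]_x maxe (loss l x) 0 =
    (th * avg (fun i => Num.max (w1 i) 0) +
     (1 - th) * avg (fun i => Num.max (w2 i) 0))%:E)%E.
  rewrite QI; last by move=> x; rewrite le_max lexx orbT.
    by apply: (real_comb (fun x => maxe (loss l x) 0%E)) => i;
      rewrite ?lx1 ?lx2 EFin_max.
  exact: measurable_maxe.
have Qmin : (\int[Q]_x maxe (- loss l x) 0 =
    (th * avg (fun i => Num.max (- w1 i) 0) +
     (1 - th) * avg (fun i => Num.max (- w2 i) 0))%:E)%E.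
  rewrite QI; last by move=> x; rewrite le_max lexx orbT.
    by apply: (real_comb (fun x => (maxe (- loss l x) 0)%E)) => i;
      rewrite ?lx1 ?lx2 -EFinN EFin_max.
  by apply: measurable_maxe => //; exact: measurableT_comp.
apply: le_ereal_sup_tmp; exists (eexpectation Q (loss l)); last first.
  rewrite /eexpectation integral_mine0 Qmax Qmin.
  rewrite (_ : (_ - _)%dE = (th * avg (fun i => Num.max (w1 i) 0 - Num.max (- w1 i) 0) +
    (1 - th) * avg (fun i => Num.max (w2 i) 0 - Num.max (- w2 i) 0))%:E); last first.
    rewrite !sumrB /=; congr EFin; ring.
  have mm (r : R) : Num.max r 0 - Num.max (- r) 0 = r.
    by rewrite /Num.max; case: ifPn; case: ifPn; rewrite -?leNgt => ? ?; lra.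
  have mm' (w : 'I_N.+1 -> R) :
      \sum_i (Num.max (w i) 0 - Num.max (- w i) 0) = \sum_i w i.
    by apply: eq_bigr => i _; exact: mm.
  by rewrite lee_fin !mm'.
exists Q => //; split; first split.
- by rewrite QE !empirical_full// !mule1 -EFinD subrKC.
- have mN : measurable_fun setT
      (fun xi : borelType process => (process_norm nrm (xi : process))%:E).
    apply/measurable_EFinP.
    have := continuous_real_measurable (process_norm_continuous nrm_norm (T := T) (z := 0)).
    by under eq_fun do rewrite subr0.
  rewrite QI//; last by move=> x; rewrite lee_fin process_norm_ge0.
  by rewrite (real_comb (fun x => (process_norm nrm x)%:E)
    (fun i => process_norm nrm (x1 i)) (fun i => process_norm nrm (x2 i)))// ltry.
- have PiP : coupling (empirical xh) Q Pi.
    move=> A mA.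
    have fstE : Pi (A `*` setT) = empirical xh A.
      rewrite PiE /empirical -ge0_muleDl ?lee_fin ?subr_ge0// -EFinD subrKC mul1e.
      congr (_ * _)%E; apply: eq_bigr => i _; rewrite !diracE.
      by congr (_%:R%:E); rewrite in_setX in_setT andbT.
    have sndE : Pi (setT `*` A) = Q A.
      rewrite PiE QE /empirical; congr (_ * (_ * _) + _ * (_ * _))%E;
        apply: eq_bigr => i _; rewrite !diracE;
        by congr (_%:R%:E); rewrite in_setX in_setT.
    by split; [exact: fstE|exact: sndE].
  apply: ge_ereal_inf; eexists; first by exists Pi; [exact: PiP|].
  have mc := measurable_process_dist nrm_norm (T := T).
  have mc' : measurable_fun setT (fun p : borelType process * borelType process =>
    (process_norm nrm ((p.1 : process) - (p.2 : process)))%:E).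
    by apply/measurable_EFinP.
  have c0 (p : borelType process * borelType process) :
      (0 <= (process_norm nrm ((p.1 : process) - (p.2 : process)))%:E)%E.
    by rewrite lee_fin process_norm_ge0.
  apply: le_trans.
    by apply: (@ge0_subset_integral _ _ _ _ _ setT) => //; exact: measurableX.
  rewrite PiI// !sumEFin -!EFinM -EFinD lee_fin; exact: cost.
Qed.

End mixture_lower_bound.

(** * Suprema, planar duality and cluster points *)

Lemma convex_setP (R : realType) (m : nat) (A : set 'rV[R]_m) : convex_set A ->
  forall x y (a : R), 0 <= a -> a <= 1 -> A x -> A y -> A (a *: x + (1 - a) *: y).
Proof.
move=> cA x y a a0 a1 Ax Ay.
by have := cA x y (Itv01 a0 a1) (mem_set Ax) (mem_set Ay); rewrite inE.
Qed.

Lemma le_ereal_reals (R : realType) (a b : \bar R) :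
  (forall v : R, (b < v%:E)%E -> (a <= v%:E)%E) -> (a <= b)%E.
Proof.
case: b => [b| |] h; last 2 first.
- exact: leey.
- case: a h => [a| |] h; last by [].
  + by have := h (a - 1 : R) (ltNyr _); rewrite lee_fin => ?; exfalso; lra.
  + by have := h 0 (ltNyr _); rewrite leye_eq.
apply/lee_addgt0Pr => e e0; rewrite -EFinD; apply: h.
by rewrite lte_fin; have : 0 < e by []; lra.
Qed.

Lemma small_share (R : realType) (J : finType) (e : R) : 0 < e ->
  exists2 d : R, 0 < d & \sum_(j : J) d <= e.
Proof.
move=> e0; have n0 : 0 < #|J|%:R + 1 :> R by rewrite ltr_wpDl.
exists (e / (#|J|%:R + 1)); first by rewrite divr_gt0.
rewrite sumr_const -[leLHS]mulr_natl mulrCA ler_piMr ?(ltW e0)//.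
by rewrite ler_pdivrMr// mul1r lerDl.
Qed.

(** The entries of v are chosen independently, so each of them can be taken close
    to its supremum simultaneously. *)
Lemma sum_sup_le (R : realType) (J : finType) (S : J -> set R) (B : R) :
  (forall j, S j !=set0) ->
  (forall v, (forall j, S j (v j)) -> \sum_j v j <= B) ->
  (forall j, has_sup (S j)) /\ \sum_j sup (S j) <= B.
Proof.
move=> S0 SB.
have [v0 hv0] := choice S0.
have hs j : has_sup (S j).
  split=> //; exists (B - \sum_(i | i != j) v0 i) => y Sy.
  have := SB (fun i => if i == j then y else v0 i).
  rewrite (bigD1 j)//= eqxx (eq_bigr v0); last by move=> i /negPf ->.
  by rewrite lerBrDr; apply => i; case: eqP => [->|_].
split=> //; apply/ler_addgt0Pr => e e0.
have [d d0 dJ] := small_share J e0.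
have ex j : exists y, S j y /\ sup (S j) - d < y.
  by have [y Sy ly] := sup_adherent d0 (hs j); exists y.
have [v hv] := choice ex.
have : \sum_j (sup (S j) - d) <= \sum_j v j.
  by apply: ler_sum => j _; apply: ltW; have [] := hv j.
have := SB v (fun j => (hv j).1).
rewrite sumrB; lra.
Qed.

(** Lagrangian duality for maximising a value p.2 under the bound eps on the cost
    p.1.  The multiplier is the infimum of the slopes of the lines from the points
    of cost below eps to (eps, v); a point of cost above eps lying over this line would, mixed with
    one of those points at cost eps, have a value above v. *)
Lemma planar_duality (R : realType) (P : set (R * R)) (eps v : R) :
  (forall p q th, P p -> P q -> 0 <= th -> th <= 1 ->
    th * p.1 + (1 - th) * q.1 <= eps -> th * p.2 + (1 - th) * q.2 <= v) ->
  (exists2 p, P p & p.1 < eps) ->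
  exists2 lam, 0 <= lam & forall p, P p -> p.2 - lam * (p.1 - eps) <= v.
Proof.
move=> mix [p0 Pp0 p0e].
have le_v p : P p -> p.1 <= eps -> p.2 <= v.
  move=> Pp pe; have := mix p p 1 Pp Pp ler01 (lexx _).
  by rewrite subrr !mul0r !addr0 !mul1r; exact.
pose S := [set (v - p.2) / (eps - p.1) | p in P `&` [set p | p.1 < eps]].
have S0 : S !=set0 by exists ((v - p0.2) / (eps - p0.1)); exists p0.
have lbS : lbound S 0.
  move=> _ [p [Pp /= pe] <-]; apply: divr_ge0; last by lra.
  by rewrite subr_ge0; apply: le_v => //; exact: ltW.
exists (inf S); first exact: lb_le_inf.
move=> p Pp; have [pe|ep|pe] := ltgtP p.1 eps.
- have : inf S <= (v - p.2) / (eps - p.1).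
    by apply: ge_inf; [exists 0|exists p].
  rewrite ler_pdivlMr ?subr_gt0//; lra.
- have : (p.2 - v) / (p.1 - eps) <= inf S.
    apply: lb_le_inf => // _ [q [Pq /= qe] <-].
    have d0 : 0 < p.1 - q.1 by lra.
    have := mix q p ((p.1 - eps) / (p.1 - q.1)) Pq Pp.
    have th0 : 0 <= (p.1 - eps) / (p.1 - q.1) by rewrite divr_ge0//; lra.
    have th1 : (p.1 - eps) / (p.1 - q.1) <= 1 by rewrite ler_pdivrMr//; lra.
    move=> /(_ th0 th1).
    have e1 : (p.1 - eps) / (p.1 - q.1) * (p.1 - q.1) = p.1 - eps.
      by rewrite divfK// gt_eqF.
    move: e1; set th := _ / _ => e1.
    have -> : th * q.1 + (1 - th) * p.1 = eps by lra.
    move=> /(_ (lexx _)) h.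
    rewrite ler_pdivrMr ?subr_gt0// mulrAC ler_pdivlMr ?subr_gt0//.
    have : (p.1 - q.1) * (th * q.2 + (1 - th) * p.2) <= (p.1 - q.1) * v.
      by rewrite ler_pM2l.
    have -> : (p.1 - q.1) * (th * q.2 + (1 - th) * p.2) =
       (th * (p.1 - q.1)) * q.2 + (p.1 - q.1) * p.2 - (th * (p.1 - q.1)) * p.2 by ring.
    rewrite e1; lra.
  rewrite ler_pdivrMr ?subr_gt0//; lra.
- by rewrite pe subrr mulr0 subr0; apply: le_v; rewrite ?pe.
Qed.

(** A summand equal to -oo would have arbitrarily small majorants, so the lower
    bound V on the sums of majorants forces all the summands to be finite. *)
Lemma sum_ge_of_majorants (R : realType) (J : finType) (e : J -> \bar R) (V : R) :
  (forall j, (e j < +oo)%E) ->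
  (forall a : J -> R, (forall j, (e j < (a j)%:E)%E) -> V <= \sum_j a j) ->
  exists r : J -> R, (forall j, e j = (r j)%:E) /\ V <= \sum_j r j.
Proof.
move=> efin hV.
have lt_fine j (d : R) : 0 < d -> (e j < (fine (e j) + d)%:E)%E.
  move=> d0; case: (e j) (efin j) => [r| |]//= _; last exact: ltNyr.
  by rewrite lte_fin ltrDl.
have real j0 : (-oo < e j0)%E.
  rewrite ltNye; apply/eqP => ej0.
  pose c := \sum_(i | i != j0) (fine (e i) + 1).
  have := hV (fun j => if j == j0 then V - 1 - c else fine (e j) + 1).
  rewrite (bigD1 j0)//= eqxx (eq_bigr (fun i => fine (e i) + 1)); last first.
    by move=> i /negPf ->.
  rewrite -/c subrK => H.
  have : V <= V - 1; last by lra.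
  by apply: H => j; case: eqP => [->|_]; [rewrite ej0 ltNyr|exact: lt_fine].
exists (fun j => fine (e j)); split=> [j|].
  by rewrite fineK// fin_numElt real efin.
apply/ler_addgt0Pr => d d0.
have [b b0 bJ] := small_share J d0.
apply: le_trans (hV _ (fun j => lt_fine j _ b0)) _.
by rewrite big_split/= lerD2l.
Qed.

(** Tychonoff's theorem, with the basic neighbourhoods of the finite product
    spelled out. *)
Lemma finite_cluster (J : finType) (V : topologicalType) (A : J -> set V)
    (x : nat -> J -> V) :
  (forall j, compact (A j)) -> (forall n j, A j (x n j)) ->
  exists p : J -> V, (forall j, A j (p j)) /\
    forall n0 (B : J -> set V), (forall j, nbhs (p j) (B j)) ->
      exists2 n, (n0 <= n)%N & forall j, B j (x n j).
Proof.
move=> cA xA.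
have cP : compact ([set f | forall j, A j (f j)] : set (prod_topology (fun _ : J => V))).
  exact: (@tychonoff J (fun=> V) A cA).
have [|p [Ap clp]] := cP (x @ \oo) _.
  by exists 0%N => // n _ j; exact: xA.
exists p; split=> // n0 B hB.
have h1 : (x @ \oo) (x @` [set n | (n0 <= n)%N]).
  by exists n0 => // n /= nn; exists n.
have h2 : nbhs p [set f : prod_topology (fun _ : J => V) | forall j, B j (f j)].
  apply: (@filter_forall _ J (fun j f => B j (f j)) _
    (nbhs_filter (p : prod_topology (fun _ : J => V)))) => j.
  exact: (@proj_continuous J (fun=> V) j p (B j) (hB j)).
have [f [[n nn <-] Bn]] := clp _ _ h1 h2.
by exists n.
Qed.

(** * Strong duality *)

Lemma dotp_le_nrm (R : realType) (m : nat) (nrm : 'rV[R]_m -> R) (p : 'rV[R]_m) :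
  is_norm nrm -> exists2 C, 0 <= C & forall x, dotp p x <= C * nrm x.
Proof.
move=> nrm_norm; have [c c0 hc] := norm_le_nrm nrm_norm.
exists ((\sum_j `|p 0 j|) * c); first by rewrite mulr_ge0 ?(ltW c0)// sumr_ge0.
move=> x; rewrite -mulrA; apply: (@le_trans _ _ ((\sum_j `|p 0 j|) * `|x|)).
  rewrite dotpE mulr_suml; apply: ler_sum => j _.
  apply: le_trans (ler_norm _) _; rewrite normrM ler_wpM2l//.
  exact: coord_le_norm.
by rewrite ler_wpM2l// sumr_ge0.
Qed.

(** Over the single point x0, the approximate duality provides a multiplier at
    which the conjugate of f is finite, that is, an affine minorant of f. *)
Lemma norm_minorant (R : realType) (m : nat) (nrm : 'rV[R]_m -> R)
    (f : 'rV[R]_m -> \bar R) (x0 : 'rV[R]_m) (t0 : R) :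
  is_norm nrm -> proper_function f -> econvex_function f ->
  lower_semicontinuous f -> f x0 = t0%:E ->
  exists B C, [/\ 0 <= B, 0 <= C & forall x, ((- (B + C * nrm x))%:E <= f x)%E].
Proof.
move=> nrm_norm fp fc fl fx0.
have cvx1 x y (a : R) : 0 <= a -> a <= 1 -> [set x0] x -> [set x0] y ->
    [set x0] (a *: x + (1 - a) *: y).
  by move=> _ _ -> ->; rewrite /= -scalerDl subrKC scale1r.
have cl1 : closed [set x0].
  by apply: compact_closed; [exact: norm_hausdorff|exact: compact_set1].
have [|z [nu [_ _ [c cE]]]] := approximate_multipliers nrm_norm fp fc fl cvx1
  cl1 (xh := 0) (s := - t0) (lexx 0) ltr01 erefl fx0.
  by move=> y ->; rewrite mul0r subr0 opprK fx0.
have [C C0 hC] := dotp_le_nrm (- (z - nu)) nrm_norm.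
exists `|c|, C; split => // x.
have : ((dotp (z - nu) x)%:E - f x <= c%:E)%E.
  by rewrite -cE; apply: ereal_sup_ubound; exists x.
case: fp => _ /(_ x); case: (f x) => [r| |]// _.
- have := ler_norm c; have := hC x; rewrite !lee_fin dotpNl; lra.
- by rewrite leey.
Qed.

Section strong_duality.
Context {R : realType} {T m K N : nat}.
Local Notation process := 'M[R]_(T, m).
Local Notation J := ('I_T * 'I_N.+1)%type.
Variables (nrm : 'rV[R]_m -> R) (Xi : 'I_T -> set 'rV[R]_m).
Variable l : 'I_T -> 'I_K -> 'rV[R]_m -> \bar R.
Variables (xihat : 'I_N.+1 -> process) (eps : R).
Hypothesis nrm_norm : is_norm nrm.
Hypothesis Xi_closed : forall t, closed (Xi t).
Hypothesis l_measurable :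
  forall t k, measurable_fun setT (l t k : borelType 'rV[R]_m -> \bar R).
Hypothesis eps_ge0 : 0 <= eps.
Hypotheses (T_gt0 : (0 < T)%N) (K_gt0 : (0 < K)%N).
Hypothesis Xi_convex : forall t x y (a : R), 0 <= a -> a <= 1 ->
  Xi t x -> Xi t y -> Xi t (a *: x + (1 - a) *: y).
Hypothesis l_concave : forall t k, [/\ proper_function (fun zeta => - l t k zeta)%E,
  econvex_function (fun zeta => - l t k zeta)%E &
  lower_semicontinuous (fun zeta => - l t k zeta)%E].
Hypothesis l_finite : forall t k, exists2 zeta, Xi t zeta & l t k zeta <> -oo%E.

Let L t (zeta : 'rV[R]_m) : \bar R := \big[maxe/-oo%E]_(k < K) l t k zeta.

Let hat (j : J) : 'rV[R]_m := row j.1 (xihat j.2).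

(** The block t of the data point i is sent to x (t, i), and e records the value
    of the t-th term of the loss there; that e is real excludes points where the
    loss is -oo. *)
Definition plan (x : J -> 'rV[R]_m) (e : J -> R) :=
  forall j, Xi j.1 (x j) /\ \big[maxe/-oo%E]_(k < K) l j.1 k (x j) = (e j)%:E.

Local Notation avg w := (N.+1%:R^-1 * \sum_(j : J) w j).

Definition plan_cost (x : J -> 'rV[R]_m) : R :=
  N.+1%:R^-1 * \sum_(j : J) nrm (x j - row j.1 (xihat j.2)).

Let sum_pairs (F : 'I_T -> 'I_N.+1 -> R) :
  \sum_i \sum_t F t i = \sum_(j : J) F j.1 j.2.
Proof. by rewrite exchange_big /= (pair_bigA _ (fun t i => F t i)). Qed.

Let l_lty t k zeta : (l t k zeta < +oo)%E.
Proof.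
have [[_ lz] _ _] := l_concave t k; move: (lz zeta).
by case: (l t k zeta) => [r| |] //= _; exact: ltry.
Qed.

Let l_point t k : exists zeta r, Xi t zeta /\ l t k zeta = r%:E.
Proof.
have [zeta Xz lz] := l_finite t k; have := l_lty t k zeta.
by case E : (l t k zeta) lz => [r| |]// _ _; exists zeta, r.
Qed.

Let l_le_L t k zeta : (l t k zeta <= L t zeta)%E.
Proof. exact: le_bigmax. Qed.

Let L_lty t zeta : (L t zeta < +oo)%E.
Proof. by apply/bigmax_ltP; split => // k _; exact: l_lty. Qed.

Let value_set lam (j : J) : set R :=
  [set r | exists x e, [/\ Xi j.1 x, L j.1 x = e%:E & r = e - lam * nrm (x - hat j)]].

Let value_set_nonempty lam j : value_set lam j !=set0.
Proof.
have [x [r [Xx lx]]] := l_point j.1 (Ordinal K_gt0).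
have := l_le_L j.1 (Ordinal K_gt0) x; have := L_lty j.1 x; rewrite lx.
case E : (L j.1 x) => [e| |]// _ _.
by exists (e - lam * nrm (x - hat j)), x, e.
Qed.

(** The Lagrangian bound over plans is a bound over independent choices, one for
    each block of each data point, and splits into real numbers s t i.
    Approximate multipliers then make (lam + dl, s + dl) feasible for every
    dl > 0, and the objective exceeds v by at most dl * (eps + T). *)
Lemma program_value_le (lam v : R) : 0 <= lam ->
  (forall x e, plan x e -> avg e - lam * (plan_cost x - eps) <= v) ->
  (program_value nrm Xi l xihat eps <= v%:E)%E.
Proof.
move=> lam0 hv.
have n0 : 0 < N.+1%:R :> R by rewrite ltr0n.
have [] := @sum_sup_le _ _ (value_set lam) (N.+1%:R * (v - lam * eps))
  (value_set_nonempty lam).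
  move=> r /choice[x] /choice[e] hxe.
  have /hv : plan x e by move=> j; have [] := hxe j.
  have -> : \sum_j r j = \sum_j e j - lam * \sum_j nrm (x j - hat j).
    rewrite mulr_sumr -sumrB; apply: eq_bigr => j _.
    by have [_ _ ->] := hxe j.
  rewrite (_ : plan_cost x = avg (fun j => nrm (x j - hat j)))// => h.
  rewrite -ler_pdivrMl// mulrBr mulrCA.
  by rewrite lerBrDr -addrA [- _ + _]addrC -opprB -mulrBr.
move=> hs sumS.
pose s t i := sup (value_set lam (t, i)).
apply/lee_addgt0Pr => d d0.
have d1 : 0 < d / (eps + T%:R) by rewrite divr_gt0// ltr_wpDl// ltr0n.
set dl := d / _ in d1.
have ex (p : 'I_T * 'I_N.+1 * 'I_K) : exists q : 'rV[R]_m * 'rV[R]_m,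
    (conjugate (fun zeta => - l p.1.1 p.2 zeta)%E (q.1 - q.2)%R
       + support_function (Xi p.1.1) q.2
       - (dotp q.1 (hat p.1))%:E <= (s p.1.1 p.1.2 + dl)%:E)%dE /\
     (dual_norm nrm q.1 <= (lam + dl)%:E)%E.
  case: p => -[t i] k /=.
  have [x0 [r0 [Xx0 lx0]]] := l_point t k.
  have [fp fc fl] := l_concave t k.
  have [||z [nu [h1 h2 _]]] := approximate_multipliers nrm_norm fp fc fl
    (@Xi_convex t) (Xi_closed (t := t)) (xh := hat (t, i)) (t0 := - r0)
    (s := s t i) lam0 d1 Xx0.
  - by rewrite lx0.
  - move=> y Xy; have := l_le_L t k y; have := l_lty t k y.
    case E : (l t k y) => [r| |]// _ rL; last exact: leey.
    rewrite -EFinN lee_fin.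
    have := L_lty t y; case LE : (L t y) rL => [e| |]// rL _.
    have : e - lam * nrm (y - hat (t, i)) <= s t i.
      by apply: sup_upper_bound; [exact: hs|exists y, e].
    by move: rL; rewrite lee_fin; lra.
  - by exists (z, nu).
have [zn hzn] := choice ex.
apply: ge_ereal_inf; exists ((lam + dl) * eps +
    N.+1%:R^-1 * \sum_i \sum_t (s t i + dl))%:E.
  exists (lam + dl), (fun t i => s t i + dl),
    (fun t i k => (zn (t, i, k)).1), (fun t i k => (zn (t, i, k)).2).
  split => //; split => i k t; first by have [] := hzn (t, i, k).
  by have [] := hzn (t, i, k).
rewrite lee_fin.
have -> : \sum_i \sum_t (s t i + dl) =
    \sum_(j : J) sup (value_set lam j) + N.+1%:R * (T%:R * dl).
  rewrite (eq_bigr (fun i => \sum_t s t i + T%:R * dl)); last first.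
    by move=> i _; rewrite big_split/= sumr_const card_ord mulr_natl.
  rewrite big_split/= sum_pairs; congr (_ + _).
  by rewrite sumr_const card_ord -[LHS]mulr_natl.
have : N.+1%:R^-1 * (\sum_(j : J) sup (value_set lam j)) <= v - lam * eps.
  by rewrite ler_pdivrMl.
have e1 : dl * (eps + T%:R) = d.
  by rewrite /dl divfK// gt_eqF// ltr_wpDl// ltr0n.
rewrite mulrDr [_ * (N.+1%:R * _)]mulrA mulVf// mul1r.
by move: e1; move: (N.+1%:R^-1 * _) (dl) => q b; lra.
Qed.

Lemma plan_mixture x1 e1 x2 e2 th : plan x1 e1 -> plan x2 e2 ->
  0 <= th -> th <= 1 -> th * plan_cost x1 + (1 - th) * plan_cost x2 <= eps ->
  ((th * avg e1 + (1 - th) * avg e2)%:E <= worst_case_expectation nrm Xi l xihat eps)%E.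
Proof.
move=> p1 p2 th0 th1 cost.
pose X (x : J -> 'rV[R]_m) i : process := \matrix_t x (t, i).
pose W (e : J -> R) i := \sum_t e (t, i).
have XW x e : plan x e -> [/\ forall i, process_set Xi (X x i),
    forall i, loss l (X x i) = (W e i)%:E,
    \sum_i W e i = \sum_j e j &
    \sum_i process_norm nrm (xihat i - X x i) = \sum_j nrm (x j - hat j)].
  move=> p; split.
  - by move=> i t; rewrite rowK; have [] := p (t, i).
  - move=> i; rewrite /loss /W -dsumEFin; apply: eq_bigr => t _.
    by rewrite rowK; have [] := p (t, i).
  - by rewrite /W (sum_pairs (fun t i => e (t, i))); apply: eq_bigr => -[].
  - rewrite /process_norm (sum_pairs (fun t i => nrm (row t (xihat i - X x i)))).
    by apply: eq_bigr => -[t i] _ /=; rewrite raddfB /= rowK (nrmB nrm_norm).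
have [X1 l1 w1 c1] := XW _ _ p1; have [X2 l2 w2 c2] := XW _ _ p2.
rewrite -w1 -w2.
apply: (mixture_le_worst_case nrm_norm Xi_closed l_measurable th0 th1
  X1 X2 l1 l2).
by rewrite c1 c2.
Qed.

(** Values grow at most linearly with the cost, because each l t k is at most an
    affine function of the norm. *)
Lemma plan_growth : exists B C, [/\ 0 <= B, 0 <= C &
  forall x e, plan x e -> avg e <= B + C * plan_cost x].
Proof.
have ex (p : 'I_T * 'I_K) : exists q : R * R, [/\ 0 <= q.1, 0 <= q.2 &
    forall x, (l p.1 p.2 x <= (q.1 + q.2 * nrm x)%:E)%E].
  have [x0 [r0 [_ lx0]]] := l_point p.1 p.2.
  have [fp fc fl] := l_concave p.1 p.2.
  have [|B [C [B0 C0 h]]] := @norm_minorant _ _ _ _ x0 (- r0) nrm_norm fp fc fl.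
    by rewrite lx0.
  exists (B, C); split => //= x.
  by rewrite -leeN2 -EFinN; exact: h.
have [q hq] := choice ex.
pose B := \sum_p (q p).1; pose C := \sum_p (q p).2.
have B0 : 0 <= B by apply: sumr_ge0 => p _; have [] := hq p.
have C0 : 0 <= C by apply: sumr_ge0 => p _; have [] := hq p.
have leB p : (q p).1 <= B.
  by rewrite /B (bigD1 p)//= lerDl; apply: sumr_ge0 => p' _; have [] := hq p'.
have leC p : (q p).2 <= C.
  by rewrite /C (bigD1 p)//= lerDl; apply: sumr_ge0 => p' _; have [] := hq p'.
exists (avg (fun j => B + C * nrm (hat j))), C; split => //.
  apply: mulr_ge0; first by rewrite invr_ge0.
  by apply: sumr_ge0 => j _; rewrite addr_ge0// mulr_ge0// (nrm_ge0 nrm_norm).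
move=> x e p.
rewrite (_ : plan_cost x = avg (fun j => nrm (x j - hat j)))//.
rewrite mulrCA -mulrDr ler_wpM2l ?invr_ge0// mulr_sumr -big_split/=.
apply: ler_sum => j _; have [_ Le] := p j.
rewrite -lee_fin -Le; apply/bigmax_leP; split; first exact: leNye.
move=> k _; have [q1 q2 h] := hq (j.1, k); apply: le_trans (h (x j)) _.
rewrite lee_fin -addrA -mulrDr; apply: lerD; first exact: leB.
apply: ler_pM => //; first exact: nrm_ge0.
have := nrm_dist nrm_norm (x j) (hat j) 0; rewrite !subr0; lra.
Qed.

Let L_usc t y (a : R) : (L t y < a%:E)%E -> nbhs y [set u | (L t u < a%:E)%E].
Proof.
move=> /bigmax_ltP[_ la].
have : \forall u \near y, forall k, (l t k u < a%:E)%E.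
  apply: (@filter_forall _ _ (fun k u => (l t k u < a%:E)%E) _
    (nbhs_filter y)) => k.
  have [_ _ lsc] := l_concave t k.
  have [|V Vy hV] := lsc y (- a); first by rewrite EFinN lteN2; exact: la.
  apply: filterS Vy => u /hV; rewrite EFinN lteN2; exact.
apply: filterS => u lu; apply/bigmax_ltP; split; first exact: ltNyr.
by move=> k _; exact: lu.
Qed.

(** Let lam grow to infinity.  By linear growth of the values, the excess
    cost - eps of the plans that beat the multiplier lam is of order 1 / lam, so
    these plans stay in a compact set; as each term of the loss is upper
    semicontinuous, a cluster point has the required cost and value. *)
Lemma plan_limit (v : R) :
  (forall x e, plan x e -> eps <= plan_cost x) ->
  (forall lam, 0 <= lam ->
    exists x e, plan x e /\ v < avg e - lam * (plan_cost x - eps)) ->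
  exists x e, [/\ plan x e, plan_cost x <= eps & v <= avg e].
Proof.
move=> cost_ge hv.
have [B [C [B0 C0 grow]]] := plan_growth.
have ex n : exists xe : (J -> 'rV[R]_m) * (J -> R), plan xe.1 xe.2 /\
    v < avg xe.2 - (n.+1%:R + C) * (plan_cost xe.1 - eps).
  have [|x [e [p h]]] := hv (n.+1%:R + C); first by rewrite addr_ge0.
  by exists (x, e).
have [xe hxe] := choice ex.
pose x n := (xe n).1; pose e n := (xe n).2.
have px n : plan (x n) (e n) by have [] := hxe n.
pose M := B - v + C * eps.
have cost_le n : n.+1%:R * (plan_cost (x n) - eps) < M.
  have [_ h] := hxe n; have := grow _ _ (px n); rewrite /M; move: h.
  rewrite -/(x n) -/(e n); move: (avg (e n)) (plan_cost (x n)) (n.+1%:R) => a c k.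
  lra.
have cost_ge0 n : 0 <= plan_cost (x n) - eps.
  by rewrite subr_ge0; exact: cost_ge (px n).
have cost_bound n : plan_cost (x n) <= eps + M.
  have := cost_le n; have := cost_ge0 n.
  have : 1 <= n.+1%:R :> R by rewrite ler1n.
  move: (plan_cost (x n)) (n.+1%:R) => c k; nra.
have n0 : 0 < N.+1%:R :> R by rewrite ltr0n.
have n1 : N.+1%:R^-1 <= 1 :> R by rewrite invf_le1// ler1n.
have costE y : plan_cost y = avg (fun j => nrm (y j - hat j)) by [].
pose A j := Xi j.1 `&` [set y | nrm (y - hat j) <= N.+1%:R * (eps + M)].
have cA j : compact (A j).
  apply: subclosed_compact (nrm_ball_compact nrm_norm (z := hat j)
    (M := N.+1%:R * (eps + M))) _; last by move=> y [].
  apply: closedI => //; apply: compact_closed; first exact: norm_hausdorff.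
  exact: nrm_ball_compact.
have xA n j : A j (x n j).
  split; first by have [] := px n j.
  rewrite /= -ler_pdivrMl//; apply: le_trans (cost_bound n).
  rewrite costE ler_pM2l ?invr_gt0// (bigD1 j)//= lerDl.
  by apply: sumr_ge0 => i _; exact: nrm_ge0.
have [p [Ap clp]] := finite_cluster cA xA.
have pcost : plan_cost p <= eps.
  apply/ler_addgt0Pr => d d0.
  have d20 : 0 < d / 2 by lra.
  have [b b0 bJ] := small_share J d20.
  pose V j := [set y | nrm (p j - hat j) - b < nrm (y - hat j)].
  have Vp j : nbhs (p j) (V j).
    have h : nbhs (nrm (p j - hat j)) [set t | nrm (p j - hat j) - b < t].
      by apply: lt_nbhsr; rewrite ltrBlDr ltrDl.
    exact: (nrm_dist_continuous nrm_norm h).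
  (* from this index on, cost_le gives an excess below d / 2 *)
  have [n nn Vn] := clp (Num.truncn (M / (d / 2))) V Vp.
  have cn : plan_cost (x n) <= eps + d / 2.
    have h1 : M / (d / 2) < n.+1%:R.
      by apply: lt_le_trans (truncnS_gt _) _; rewrite ler_nat.
    rewrite ltr_pdivrMr// in h1.
    have : n.+1%:R * (plan_cost (x n) - eps) < n.+1%:R * (d / 2).
      exact: lt_trans (cost_le n) h1.
    rewrite ltr_pM2l ?ltr0n//; lra.
  have : plan_cost p <= plan_cost (x n) + d / 2.
    apply: (@le_trans _ _ (plan_cost (x n) + avg (fun=> b))).
      rewrite !costE -mulrDr ler_pM2l ?invr_gt0// -big_split/=.
      apply: ler_sum => j _; have := Vn j; rewrite /V/=; lra.
    rewrite lerD2l; apply: le_trans bJ.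
    by rewrite ler_piMl// sumr_ge0// => j _; exact: ltW.
  lra.
have [|a La|r [Lr vr]] := @sum_ge_of_majorants _ _ (fun j => L j.1 (p j)) (N.+1%:R * v).
- by move=> j; exact: L_lty.
- have [n _ Ln] := clp 0 (fun j => [set u | (L j.1 u < (a j)%:E)%E])
    (fun j => L_usc (La j)).
  have [_ hn] := hxe n.
  have ve : v <= avg (e n).
    have : 0 <= (n.+1%:R + C) * (plan_cost (x n) - eps).
      by apply: mulr_ge0 => //; rewrite addr_ge0.
    move: hn; rewrite -/(x n) -/(e n).
    by move: (avg (e n)) (_ * (plan_cost (x n) - eps)) => q s; lra.
  rewrite -ler_pdivlMl//; apply: le_trans ve _; rewrite ler_pM2l ?invr_gt0//.
  apply: ler_sum => j _; apply: ltW; rewrite -lte_fin.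
  by have [_ <-] := px n j; exact: (Ln j).
exists p, r; split => //; last by rewrite ler_pdivlMl.
by move=> j; split; [have [] := Ap j|exact: Lr].
Qed.

Theorem strong_duality :
  (program_value nrm Xi l xihat eps <= worst_case_expectation nrm Xi l xihat eps)%E.
Proof.
apply: le_ereal_reals => v worst_v.
have mix x1 e1 x2 e2 th : plan x1 e1 -> plan x2 e2 -> 0 <= th -> th <= 1 ->
    th * plan_cost x1 + (1 - th) * plan_cost x2 <= eps ->
    th * avg e1 + (1 - th) * avg e2 < v.
  move=> p1 p2 th0 th1 cost.
  by rewrite -lte_fin; apply: le_lt_trans worst_v; exact: plan_mixture.
have [[x0 [e0 [p0 c0]]]|no_slack] :=
  pselect (exists x e, plan x e /\ plan_cost x < eps).
  pose P := [set q : R * R | exists x e, plan x e /\ q = (plan_cost x, avg e)].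
  have [||lam lam0 hlam] := @planar_duality _ P eps v.
  - move=> _ _ th [x1 [e1 [p1 ->]]] [x2 [e2 [p2 ->]]] th0 th1 cost /=.
    by apply: ltW; exact: mix cost.
  - by exists (plan_cost x0, avg e0) => //; exists x0, e0.
  apply: (program_value_le lam0) => x e p.
  by apply: (hlam (plan_cost x, avg e)); exists x, e.
have cost_ge x e : plan x e -> eps <= plan_cost x.
  by move=> p; rewrite leNgt; apply/negP => c; apply: no_slack; exists x, e.
apply: contrapT => not_le.
have [|x [e [p c ve]]] := plan_limit cost_ge (v := v).
  move=> lam lam0; apply: contrapT => none; apply: not_le.
  apply: (program_value_le lam0) => x e p; rewrite leNgt; apply/negP => h.
  by apply: none; exists x, e.
have := mix x e x e 1 p p ler01 (lexx _).
by rewrite subrr !mul0r !addr0 !mul1r => /(_ c); rewrite ltNge ve.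
Qed.

End strong_duality.

Theorem theorem6p1 (R : realType) (T m K N : nat)
  (T_gt0 : (0 < T)%N) (K_gt0 : (0 < K)%N) (N_gt0 : (0 < N)%N)
  (nrm : 'rV[R]_m -> R) (nrm_norm : is_norm nrm)
  (Xi : 'I_T -> set 'rV[R]_m)
  (Xi_nonempty : forall t, Xi t !=set0) (Xi_closed : forall t, closed (Xi t))
  (xihat : 'I_N -> 'M[R]_(T, m)) (xihat_in : forall i, process_set Xi (xihat i))
  (l : 'I_T -> 'I_K -> 'rV[R]_m -> \bar R)
  (l_measurable : forall t k,
     measurable_fun setT (l t k : borelType 'rV[R]_m -> \bar R))
  (eps : R) (eps_ge0 : 0 <= eps) :
  (worst_case_expectation nrm Xi l xihat eps
     <= program_value nrm Xi l xihat eps)%E /\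
  ((forall t, convex_set (Xi t) /\ closed (Xi t)) ->
   (forall t k, [/\ proper_function (fun zeta => - l t k zeta)%E,
                    econvex_function (fun zeta => - l t k zeta)%E &
                    lower_semicontinuous (fun zeta => - l t k zeta)%E]) ->
   (forall t k, exists2 zeta, Xi t zeta & l t k zeta <> -oo%E) ->
   worst_case_expectation nrm Xi l xihat eps
     = program_value nrm Xi l xihat eps).
Proof.
case: N N_gt0 xihat xihat_in => [//|N'] _ xihat xihat_in.
have weak := weak_duality eps nrm_norm Xi_closed xihat_in l_measurable T_gt0 K_gt0.
split=> // Xi_convex l_concave l_finite; apply/eqP; rewrite eq_le weak /=.
apply: strong_duality => // t.
by apply: convex_setP; have [] := Xi_convex t.
Qed.
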